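(* Let $m$ be a positive integer, and let $f:[0,1]\to\mathbb{C}$ be a function having a continuous $m$-th derivative on $[0,1]$. For a positive integer $p$, let $$\mathcal{T}^{(0)}_p(f)=\frac{f(0)+f(1)}{2p}+\frac1p\sum_{k=1}^{p-1}f\left(\frac kp\right)$$ be the trapezoidal rule, and for $\ell\ge1$ define inductively Romberg's rule of order $\ell$ by $$\mathcal{T}^{(\ell)}_p(f)=\frac{4^\ell\,\mathcal{T}^{(\ell-1)}_{2p}(f)-\mathcal{T}^{(\ell-1)}_p(f)}{4^\ell-1}.$$ For each such $\ell$ and $p$, let $\mathcal{E}^{(\ell)}_m(p)$ be the quantity defined by the equality $$\int_0^1f(t)\,dt=\mathcal{T}^{(\ell)}_p(f)-\frac{(-1)^\ell}{2^{\ell(1+\ell)}}\sum_{\ell<k\le m/2}\binom{k-1}{\ell}_{1/4}\frac{b_{2k}}{(2k)!\,p^{2k}}\left(f^{(2k-1)}(1)-f^{(2k-1)}(0)\right)+\mathcal{E}^{(\ell)}_m(p).$$ Then $\lim_{p\to\infty}p^m\,\mathcal{E}^{(\ell)}_m(p)=0$. Moreover, if $m\ge2\ell+2$, then for every positive integer $p$ $$\left|\mathcal{E}^{(\ell)}_m(p)\right|\le\frac{16}{\pi}\cdot\frac{1}{2^{\ell(1+\ell)}(2\pi p)^m}\,\sup_{[0,1]}|f^{(m)}|.$$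
   Context: The Bernoulli polynomials $(B_n)_{n\ge 0}$ are the unique sequence of real polynomials with $B_0(X)=1$ and, for all $n\ge1$, $B_n(X+1)-B_n(X)=nX^{n-1}$ and $\int_0^1B_n(t)\,dt=0$; the Bernoulli numbers are $b_n=B_n(0)$. The finite $q$-Pochhammer symbol is $(z;q)_n=\prod_{k=1}^n(1-zq^{k-1})$, and the $q$-binomial coefficient is $\binom{n}{m}_q=\frac{(q;q)_n}{(q;q)_{n-m}(q;q)_m}$ for $0\le m\le n$; here $q=1/4$. Empty sums are $0$. *)

(* Defs.v *)
From Stdlib Require Import Reals Lra Lia.
From Coquelicot Require Import Coquelicot.
Open Scope R_scope.

Definition is_polynomial (P : R -> R) : Prop :=
  exists (d : nat) (a : nat -> R),
    forall x : R, P x = sum_f_R0 (fun i => a i * x ^ i) d.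

Definition bernoulli_polynomials (B : nat -> R -> R) : Prop :=
  (forall n : nat, is_polynomial (B n)) /\
  (forall x : R, B 0%nat x = 1) /\
  (forall n : nat, (1 <= n)%nat ->
     (forall x : R, B n (x + 1) - B n x = INR n * x ^ (n - 1)) /\
     RInt (B n) 0 1 = 0).

Fixpoint qpoch (z q : R) (n : nat) : R :=
  match n with
  | O => 1
  | S k => qpoch z q k * (1 - z * q ^ k)
  end.

(* The q-binomial coefficient only for m <= n: [n - m] is truncated. *)
Definition qbinom (q : R) (n m : nat) : R :=
  qpoch q q n / (qpoch q q (n - m) * qpoch q q m).

(* A function [0,1] -> C is represented by a total function [R -> C] of which
   only the values on [0,1] matter: what follows, evaluated at points of [0,1],
   and [RInt f 0 1] do not depend on the values taken elsewhere. *)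

Definition I01 (x : R) : Prop := 0 <= x <= 1.

(* [is_derive], with [locally x] replaced by the neighbourhoods of x relative
   to [0,1]; the derivative is one-sided at 0 and at 1. *)
Definition is_derive_I01 (f : R -> C) (x : R) (l : C) : Prop :=
  filterdiff (V := C_R_NormedModule) f (within I01 (locally x))
    (fun h : R => scal h l).

Definition ex_derive_I01 (f : R -> C) (x : R) : Prop :=
  exists l : C, is_derive_I01 f x l.

Definition Derive_I01 (f : R -> C) (x : R) : C :=
  iota (T := C_R_CompleteNormedModule) (is_derive_I01 f x).

Fixpoint Derive_n_I01 (f : R -> C) (n : nat) : R -> C :=
  match n with
  | O => f
  | S k => Derive_I01 (Derive_n_I01 f k)
  end.

Definition class_C_I01 (m : nat) (f : R -> C) : Prop :=
  (forall (k : nat) (x : R),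
     (k < m)%nat -> I01 x -> ex_derive_I01 (Derive_n_I01 f k) x) /\
  continuous_on I01 (Derive_n_I01 f m).

(* [real] sends infinite values to 0; the supremum is finite as soon as [g] is
   bounded on [0,1], in particular when it is continuous on [0,1]. *)
Definition sup_I01 (g : R -> C) : R :=
  real (Lub_Rbar (fun y => exists t : R, I01 t /\ y = Cmod (g t))).

Definition trapezoid (f : R -> C) (p : nat) : C :=
  ((f 0%R + f 1%R) / RtoC (2 * INR p)
   + RtoC (/ INR p) * sum_n_m (fun k => f (INR k / INR p)%R) 1 (p - 1))%C.

Fixpoint romberg (f : R -> C) (l p : nat) : C :=
  match l with
  | O => trapezoid f p
  | S l' => ((RtoC (4 ^ l) * romberg f l' (2 * p) - romberg f l' p)
              / RtoC (4 ^ l - 1))%C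
  end.

Lemma is_derive_Rplus (u v : R -> R) (x a b : R) :
  is_derive u x a -> is_derive v x b -> is_derive (fun t => u t + v t) x (a + b).
Proof. apply (is_derive_plus (K := R_AbsRing) (V := R_NormedModule)). Qed.

Lemma is_derive_Rminus (u v : R -> R) (x a b : R) :
  is_derive u x a -> is_derive v x b -> is_derive (fun t => u t - v t) x (a - b).
Proof. apply (is_derive_minus (K := R_AbsRing) (V := R_NormedModule)). Qed.

Lemma is_polynomial_derivable (P : R -> R) :
  is_polynomial P -> forall x, ex_derive P x.
Proof.
  intros [d [a H]] x.
  apply (ex_derive_ext (fun x => sum_f_R0 (fun i => a i * x ^ i) d)).
  { intros t; symmetry; apply H. }
  clear H; induction d as [|d IH]; simpl sum_f_R0.
  - auto_derive; auto.
  - apply (ex_derive_plus (V := R_NormedModule)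
             (fun x => sum_f_R0 (fun i => a i * x ^ i) d)
             (fun x => a (S d) * x ^ S d)); [exact IH | auto_derive; auto].
Qed.

Lemma is_polynomial_continuous (P : R -> R) :
  is_polynomial P -> forall x, continuous P x.
Proof.
  intros H x; apply (ex_derive_continuous P x), is_polynomial_derivable, H.
Qed.

Lemma is_polynomial_ex_RInt (P : R -> R) (a b : R) :
  is_polynomial P -> ex_RInt P a b.
Proof.
  intros H; apply (ex_RInt_continuous (V := R_CompleteNormedModule)).
  intros; apply is_polynomial_continuous, H.
Qed.

Lemma is_derive_primitive (P : R -> R) (x : R) :
  is_polynomial P -> is_derive (fun y => RInt P 0 y) x (P x).
Proof.
  intros H; apply (is_derive_RInt P _ 0).
  - apply filter_forall; intros y.
    apply (RInt_correct (V := R_CompleteNormedModule)), is_polynomial_ex_RInt, H.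
  - apply is_polynomial_continuous, H.
Qed.

Lemma derive_zero_constant (g : R -> R) :
  (forall x, is_derive g x 0) -> forall x, g x = g 0.
Proof.
  intros H x.
  destruct (MVT_gen g 0 x (fun _ => 0)) as [c [_ Hc]].
  - intros; apply H.
  - intros t _; apply continuity_pt_filterlim.
    apply (ex_derive_continuous (K := R_AbsRing) g t); exists 0; apply H.
  - lra.
Qed.

Lemma is_polynomial_primitive (P : R -> R) :
  is_polynomial P -> is_polynomial (fun y => RInt P 0 y).
Proof.
  intros HP; pose proof HP as [d [a H]].
  exists (S d), (fun i => match i with O => 0 | S j => a j / INR (S j) end).
  intros x.
  set (Q := fun x => sum_f_R0 (fun i => match i with O => 0
                       | S j => a j / INR (S j) end * x ^ i) (S d)).
  assert (HQ : forall x, is_derive Q x (P x)).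
  { intros t; rewrite H; unfold Q; clear; induction d as [|d IH].
    - simpl; auto_derive; auto; field.
    - eapply is_derive_ext.
      { intros y; symmetry; apply tech5. }
      rewrite tech5; apply is_derive_Rplus; [exact IH|].
      replace (a (S d) * t ^ S d) with
        (a (S d) / INR (S (S d)) * (INR (S (S d)) * 1 * t ^ pred (S (S d)))).
      2:{ simpl pred; field; apply not_0_INR; discriminate. }
      apply is_derive_scal, is_derive_pow, (is_derive_id (K := R_AbsRing)). }
  assert (E : RInt P 0 x - Q x = RInt P 0 0 - Q 0).
  { apply (derive_zero_constant (fun x => RInt P 0 x - Q x)); intros t.
    replace 0 with (P t - P t) at 1 by ring.
    apply is_derive_Rminus;
      [apply is_derive_primitive, HP | apply HQ]. }
  rewrite RInt_point in E; change (@zero _) with 0 in E.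
  assert (Q0 : Q 0 = 0).
  { unfold Q; clear; induction d as [|d IH]; [simpl; ring|].
    rewrite tech5, IH; simpl; ring. }
  fold (Q x); lra.
Qed.

Lemma is_polynomial_affine (P : R -> R) (c e : R) :
  is_polynomial P -> is_polynomial (fun y => c * (P y - e)).
Proof.
  intros [d [a H]].
  exists d, (fun i => match i with O => c * (a O - e) | S _ => c * a i end).
  intros x; rewrite H; clear H; induction d as [|d IH]; [simpl; ring|].
  rewrite !tech5, <- IH; ring.
Qed.

Theorem bernoulli_polynomials_exist :
  exists B : nat -> R -> R, bernoulli_polynomials B.
Proof.
  set (next n b := fun x => INR (S n) *
         (RInt b 0 x - RInt (fun y => RInt b 0 y) 0 1)).
  exists (fix B n := match n with O => fun _ => 1 | S k => next k (B k) end).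
  set (B := fix B n := match n with O => fun _ => 1 | S k => next k (B k) end).
  assert (H : forall n, is_polynomial (B n) /\
            (forall x, B n (x + 1) - B n x = INR n * x ^ (n - 1)) /\
            RInt (B n) 0 1 = 0 ^ n).
  { induction n as [|n [HP [HD HI]]].
    - simpl; repeat split.
      + exists O, (fun _ => 1); intros; simpl; ring.
      + intros; ring.
      + rewrite RInt_const; compute; ring.
    - change (B (S n)) with (next n (B n)); unfold next.
      pose proof (is_polynomial_primitive _ HP) as HP1.
      split; [apply is_polynomial_affine, HP1 | split].
      + intros x; replace (S n - 1)%nat with n by lia.
        set (g := fun x => RInt (B n) 0 (x + 1) - RInt (B n) 0 x - x ^ n).
        assert (Hg : g x = g 0).
        { apply derive_zero_constant; intros t.
          replace 0 with (1 * B n (t + 1) - B n t - INR n * t ^ (n - 1)).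
          2:{ rewrite <- (HD t); ring. }
          apply is_derive_Rminus.
          - apply is_derive_Rminus.
            + apply (is_derive_comp (fun y => RInt (B n) 0 y) (fun x => x + 1)).
              * apply is_derive_primitive, HP.
              * auto_derive; auto.
            + apply is_derive_primitive, HP.
          - auto_derive; auto; replace (Init.Nat.pred n) with (n - 1)%nat by lia.
            ring. }
        unfold g in Hg; rewrite Rplus_0_l, HI, RInt_point in Hg.
        change (@zero _) with 0 in Hg.
        replace (RInt (B n) 0 (x + 1)) with (RInt (B n) 0 x + x ^ n) by lra.
        ring.
      + set (c := RInt (fun y => RInt (B n) 0 y) 0 1).
        replace (0 ^ S n) with (INR (S n) * (c - (1 - 0) * c)) by (simpl; ring).
        apply is_RInt_unique, (is_RInt_scal (V := R_NormedModule)).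
        apply (is_RInt_minus (V := R_NormedModule)
                 (fun x => RInt (B n) 0 x) (fun _ => c)).
        * apply (RInt_correct (V := R_CompleteNormedModule)).
          apply is_polynomial_ex_RInt, HP1.
        * apply (is_RInt_const (V := R_NormedModule)). }
  split; [intros n; apply H | split; [reflexivity|]].
  intros n Hn; destruct (H n) as [_ [HD HI]]; split; [exact HD|].
  rewrite HI; destruct n; [lia | simpl; ring].
Qed.

(* Main.v *)
(* Euler-Maclaurin summation writes the error of the trapezoidal rule as
   (-1)^m / p^m times the sum over the cells [k/p, (k+1)/p] of the integrals of
   P_m(pt - k) f^(m)(t), where P_m = B_m / m!. As P_m has mean zero on [0,1], f^(m)
   may be replaced on each cell by its oscillation, which gives the limit.
   Romberg's rule is a linear extrapolation acting on sequences in p: it fixes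
   constants, multiplies p^(-2k) by a factor that vanishes for k <= l and is the
   q-binomial coefficient of the statement for k > l, and therefore turns the error
   of the trapezoidal rule into E.
   For the explicit bound, Wirtinger's inequality with the sharp constant 2 pi gives
   |P_m|_2 <= |P_1|_2 / (2 pi)^(m-1), with |P_1|_2 = 1 / sqrt 12 <= 29/100, and the
   extrapolation multiplies a bound C / p^m by at most
   prod_{i<=l} (4^i / 2^m + 1) / (4^i - 1) <= (33/16) / 2^(l(l+1)).
   Complex values are handled through the real functionals z |-> c Re z + s Im z
   with c^2 + s^2 = 1. *)

Require Import Defs.
From Stdlib Require Import Reals Factorial Lra Lia.
From Coquelicot Require Import Coquelicot.
Open Scope R_scope.

(** * Calculus of continuous real functions *)

Lemma is_derive_cont (f : R -> R) (x l : R) : is_derive f x l -> continuous f x.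
Proof.
  intros H; apply (ex_derive_continuous (K := R_AbsRing) (V := R_NormedModule)).
  now exists l.
Qed.

Lemma is_derive_eq (f : R -> R) (x l l' : R) :
  is_derive f x l -> l = l' -> is_derive f x l'.
Proof. now intros H <-. Qed.

Lemma ex_RInt_cont (f : R -> R) (a b : R) :
  (forall x, continuous f x) -> ex_RInt f a b.
Proof.
  intros H; apply (ex_RInt_continuous (V := R_CompleteNormedModule)); auto.
Qed.

Lemma continuous_Rmult (u v : R -> R) (x : R) :
  continuous u x -> continuous v x -> continuous (fun t => u t * v t) x.
Proof. apply (continuous_mult (K := R_AbsRing)). Qed.

Lemma continuous_Rplus (u v : R -> R) (x : R) :
  continuous u x -> continuous v x -> continuous (fun t => u t + v t) x.
Proof. apply (continuous_plus (V := R_NormedModule)). Qed.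

Lemma continuous_Rminus (u v : R -> R) (x : R) :
  continuous u x -> continuous v x -> continuous (fun t => u t - v t) x.
Proof. apply (continuous_minus (V := R_NormedModule)). Qed.

Lemma continuous_Rdiv_const (u : R -> R) (c x : R) :
  continuous u x -> continuous (fun t => u t / c) x.
Proof. intros; apply continuous_Rmult; [auto | apply continuous_const]. Qed.

Lemma continuous_Rpow (u : R -> R) (n : nat) (x : R) :
  continuous u x -> continuous (fun t => u t ^ n) x.
Proof.
  intros H; induction n; simpl; [apply continuous_const|].
  now apply continuous_Rmult.
Qed.

(* Equations between values of [RInt] live in the carrier of a canonical
   structure, which [ring] and [lra] do not recognise as [R]. *)
Ltac toR :=
  repeat match goal with
    |- context [@RInt ?V ?f ?a ?b] =>
      let r := fresh "r" in
      pose (r := @RInt V f a b : R); change (@RInt V f a b) with r; clearbody r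
    end;
  match goal with |- @eq _ ?a ?b => change (@eq R a b) end.

Ltac cont :=
  lazymatch goal with
  | |- continuous (fun _ => ?c) _ => apply continuous_const
  | |- continuous (fun x => @?u x + @?v x) _ => apply (continuous_Rplus u v); cont
  | |- continuous (fun x => @?u x - @?v x) _ => apply (continuous_Rminus u v); cont
  | |- continuous (fun x => @?u x / ?c) _ => apply (continuous_Rdiv_const u c); cont
  | |- continuous (fun x => @?u x * @?v x) _ => apply (continuous_Rmult u v); cont
  | |- continuous (fun x => @?u x ^ ?n) _ => apply (continuous_Rpow u n); cont
  | |- _ => first [solve [auto] | apply continuous_id | idtac]
  end.

Lemma RInt_FTC (f df : R -> R) (a b : R) :
  a <= b ->
  (forall x, a <= x <= b -> is_derive f x (df x)) ->
  (forall x, a <= x <= b -> continuous df x) -> RInt df a b = f b - f a.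
Proof.
  intros Hab H1 H2; apply is_RInt_unique.
  apply (is_RInt_derive (V := R_CompleteNormedModule) f df); intros x;
    rewrite Rmin_left, Rmax_right; auto.
Qed.

Lemma RInt_split (f : R -> R) (a b c : R) :
  (forall x, continuous f x) -> RInt f a b + RInt f b c = RInt f a c.
Proof.
  intros H; apply (RInt_Chasles (V := R_CompleteNormedModule));
    now apply ex_RInt_cont.
Qed.

Lemma RInt_add (f g : R -> R) (a b : R) :
  (forall x, continuous f x) -> (forall x, continuous g x) ->
  RInt (fun x => f x + g x) a b = RInt f a b + RInt g a b.
Proof.
  intros; apply (RInt_plus (V := R_CompleteNormedModule)); now apply ex_RInt_cont.
Qed.

Lemma RInt_sub (f g : R -> R) (a b : R) :
  (forall x, continuous f x) -> (forall x, continuous g x) ->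
  RInt (fun x => f x - g x) a b = RInt f a b - RInt g a b.
Proof.
  intros; apply (RInt_minus (V := R_CompleteNormedModule)); now apply ex_RInt_cont.
Qed.

Lemma RInt_mul_const (f : R -> R) (k a b : R) :
  (forall x, continuous f x) ->
  RInt (fun x => k * f x) a b = k * RInt f a b.
Proof.
  intros; apply (RInt_scal (V := R_CompleteNormedModule)); now apply ex_RInt_cont.
Qed.

Lemma RInt_cst (k a b : R) : RInt (fun _ => k) a b = (b - a) * k.
Proof. apply (RInt_const (V := R_CompleteNormedModule)). Qed.

Lemma RInt_eq (f g : R -> R) (a b : R) :
  (forall x, f x = g x) -> RInt f a b = RInt g a b.
Proof. intros H; apply RInt_ext; auto. Qed.

Lemma is_derive_zero_constant_on (u : R -> R) (a b : R) :
  a <= b ->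
  (forall x, a < x < b -> is_derive u x 0) ->
  (forall x, a <= x <= b -> continuous u x) ->
  u b = u a.
Proof.
  intros Hab H1 H2.
  destruct (MVT_gen u a b (fun _ => 0)) as [c [_ Hc]];
    rewrite ?Rmin_left, ?Rmax_right by lra; auto.
  - intros x Hx; apply continuity_pt_filterlim, H2, Hx.
  - lra.
Qed.

(** * Bernoulli polynomials *)

(** Brings two coefficient lists to a common length, so that polynomials can be subtracted
    coefficientwise. *)
Lemma is_polynomial_pad (d e : nat) (a : nat -> R) :
  (d <= e)%nat ->
  forall x, sum_f_R0 (fun i => a i * x ^ i) d =
            sum_f_R0 (fun i => (if Nat.leb i d then a i else 0) * x ^ i) e.
Proof.
  intros Hde x; induction Hde as [|e Hde IH].
  - apply sum_eq; intros i Hi; apply Nat.leb_le in Hi; now rewrite Hi.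
  - rewrite tech5, <- IH.
    replace (Nat.leb (S e) d) with false by (symmetry; apply Nat.leb_gt; lia).
    ring.
Qed.

Lemma is_polynomial_sub_scal (P Q : R -> R) (c : R) :
  is_polynomial P -> is_polynomial Q -> is_polynomial (fun x => P x - c * Q x).
Proof.
  intros [d [a HP]] [e [b HQ]].
  exists (Nat.max d e), (fun i => (if Nat.leb i d then a i else 0)
                          - c * (if Nat.leb i e then b i else 0)).
  intros x; rewrite HP, HQ.
  rewrite (is_polynomial_pad d (Nat.max d e)) by lia.
  rewrite (is_polynomial_pad e (Nat.max d e)) by lia.
  rewrite scal_sum, <- minus_sum; apply sum_eq; intros; ring.
Qed.

Lemma is_derive_monomial_sum (a : nat -> R) (d : nat) (x : R) :
  is_derive (fun x => sum_f_R0 (fun i => a i * x ^ i) (S d)) x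
    (sum_f_R0 (fun i => INR (S i) * a (S i) * x ^ i) d).
Proof.
  induction d as [|d IH].
  - simpl; auto_derive; auto; simpl; ring.
  - rewrite tech5.
    apply (is_derive_ext (fun x => sum_f_R0 (fun i => a i * x ^ i) (S d)
                                   + a (S (S d)) * x ^ S (S d))).
    { intros t; symmetry; apply tech5. }
    apply is_derive_Rplus; [exact IH|].
    replace (INR (S (S d)) * a (S (S d)) * x ^ S d) with
      (a (S (S d)) * (INR (S (S d)) * 1 * x ^ pred (S (S d)))) by (simpl pred; ring).
    apply is_derive_scal, is_derive_pow, (is_derive_id (K := R_AbsRing)).
Qed.

(** Induction on the degree: the derivative is periodic of lower degree, hence constant, so the
    polynomial is affine; an affine function taking equal values at 0 and 1 is constant. *)
Lemma periodic_monomial_sum_constant (d : nat) : forall a : nat -> R,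
  (forall x, sum_f_R0 (fun i => a i * (x + 1) ^ i) d
             = sum_f_R0 (fun i => a i * x ^ i) d) ->
  forall x, sum_f_R0 (fun i => a i * x ^ i) d = sum_f_R0 (fun i => a i * 0 ^ i) d.
Proof.
  induction d as [|d IH]; intros a H x; [reflexivity|].
  set (P := fun x => sum_f_R0 (fun i => a i * x ^ i) (S d)).
  set (Q := fun x => sum_f_R0 (fun i => INR (S i) * a (S i) * x ^ i) d).
  assert (HP : forall x, is_derive P x (Q x)) by (intros; apply is_derive_monomial_sum).
  assert (HQ : forall x, Q x = Q 0).
  { apply (IH (fun i => INR (S i) * a (S i))); intros t.
    change (Q (t + 1) = Q t).
    rewrite <- (is_derive_unique P t (Q t) (HP t)).
    symmetry; apply is_derive_unique.
    apply (is_derive_ext (fun t => P (t + 1))); [exact H|].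
    replace (Q (t + 1)) with (1 * Q (t + 1)) by ring.
    apply (is_derive_comp P (fun t => t + 1)); [apply HP | auto_derive; auto]. }
  assert (E : forall x, P x - Q 0 * x = P 0 - Q 0 * 0).
  { apply (derive_zero_constant (fun x => P x - Q 0 * x)); intros t.
    apply (is_derive_eq _ _ (Q t - Q 0)); [|rewrite (HQ t); ring].
    apply is_derive_Rminus; [apply HP | auto_derive; auto; ring]. }
  assert (H1 : P 1 = P 0).
  { rewrite <- (Rplus_0_l 1); apply H. }
  change (P x = P 0).
  specialize (E x) as Ex; specialize (E 1); replace (Q 0) with 0 in Ex by lra; lra.
Qed.

Lemma is_polynomial_periodic_constant (P : R -> R) :
  is_polynomial P -> (forall x, P (x + 1) = P x) -> forall x, P x = P 0.
Proof.
  intros [d [a H]] Hper x; rewrite !H.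
  apply periodic_monomial_sum_constant; intros t; rewrite <- !H; apply Hper.
Qed.

Lemma is_polynomial_ex_derivative (P : R -> R) :
  is_polynomial P ->
  exists Q, is_polynomial Q /\ forall x, is_derive P x (Q x).
Proof.
  intros [d [a H]].
  exists (fun x => sum_f_R0 (fun i => INR (S i) * (if Nat.leb (S i) d then a (S i) else 0)
                                    * x ^ i) d); split.
  - now exists d, (fun i => INR (S i) * (if Nat.leb (S i) d then a (S i) else 0)).
  - intros x.
    apply (is_derive_ext
      (fun x => sum_f_R0 (fun i => (if Nat.leb i d then a i else 0) * x ^ i) (S d))).
    + intros t; rewrite H; symmetry; apply is_polynomial_pad; lia.
    + apply (is_derive_monomial_sum (fun i => if Nat.leb i d then a i else 0)).
Qed.

Lemma bernoulli_continuous (B : nat -> R -> R) (n : nat) (x : R) :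
  bernoulli_polynomials B -> continuous (B n) x.
Proof. intros [H _]; apply is_polynomial_continuous, H. Qed.

(** The defect [B (S n)' - (n + 1) B n] is a polynomial of period 1, because both terms have forward
    difference [(n + 1) n x^(n-1)]. It is therefore constant, and its mean over [0,1] is zero. *)
Lemma bernoulli_derive (B : nat -> R -> R) (n : nat) (x : R) :
  bernoulli_polynomials B -> is_derive (B (S n)) x (INR (S n) * B n x).
Proof.
  intros [HP [H0 HB]].
  destruct (is_polynomial_ex_derivative (B (S n)) (HP _)) as [Q [HQ HQd]].
  set (D := fun x => Q x - INR (S n) * B n x).
  assert (HD : is_polynomial D) by (apply is_polynomial_sub_scal; auto).
  assert (Hc : forall x, D x = D 0).
  { apply is_polynomial_periodic_constant; [exact HD|]; intros t.
    assert (EQ : Q (t + 1) - Q t = INR (S n) * (INR n * t ^ (n - 1))).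
    { destruct (HB (S n) ltac:(lia)) as [Hs _].
      transitivity (Derive (fun t => B (S n) (t + 1) - B (S n) t) t).
      - symmetry; apply is_derive_unique; apply is_derive_Rminus; [|apply HQd].
        replace (Q (t + 1)) with (1 * Q (t + 1)) by ring.
        apply (is_derive_comp (B (S n)) (fun t => t + 1)); [apply HQd | auto_derive; auto].
      - apply is_derive_unique.
        apply (is_derive_ext (fun t => INR (S n) * t ^ (S n - 1))); [intros; symmetry; apply Hs|].
        replace (S n - 1)%nat with n by lia.
        apply is_derive_scal.
        replace (INR n * t ^ (n - 1)) with (INR n * 1 * t ^ pred n)
          by (replace (n - 1)%nat with (pred n) by lia; ring).
        apply is_derive_pow, (is_derive_id (K := R_AbsRing)). }
    assert (EB : B n (t + 1) - B n t = INR n * t ^ (n - 1)).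
    { destruct n; [rewrite !H0; simpl; ring | apply HB; lia]. }
    unfold D; nra. }
  assert (Hi : RInt D 0 1 = 0).
  { unfold D; rewrite RInt_sub, RInt_mul_const.
    - rewrite (RInt_FTC (B (S n)) Q) by
        (try lra; intros; try apply is_polynomial_continuous; auto).
      destruct (HB (S n) ltac:(lia)) as [Hs _].
      specialize (Hs 0); rewrite Rplus_0_l in Hs; rewrite Hs.
      replace (S n - 1)%nat with n by lia.
      (* Both means equal [(n + 1) 0^n]; the case [n = 0], where [B 0] has mean 1, is the one in
         which this is not zero. *)
      destruct n as [|n].
      + rewrite (RInt_eq _ (fun _ => 1)) by auto; rewrite RInt_cst; simpl; ring.
      + destruct (HB (S n) ltac:(lia)) as [_ Hi]; rewrite Hi; simpl; ring.
    - apply is_polynomial_continuous, HP.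
    - apply is_polynomial_continuous, HQ.
    - intros; apply continuous_Rmult; [apply continuous_const|].
      apply is_polynomial_continuous, HP. }
  rewrite (RInt_eq _ (fun _ => D 0)), RInt_cst in Hi by auto.
  specialize (Hc x); unfold D at 1 in Hc.
  replace (INR (S n) * B n x) with (Q x) by lra; apply HQd.
Qed.

Lemma bernoulli_1 (B : nat -> R -> R) (x : R) :
  bernoulli_polynomials B -> B 1%nat x = x - 1 / 2.
Proof.
  intros hB; pose proof hB as [_ [H0 HB]].
  assert (E : forall x, B 1%nat x = x + B 1%nat 0).
  { intros t; enough (B 1%nat t - t = B 1%nat 0 - 0) by lra.
    apply (derive_zero_constant (fun t => B 1%nat t - t)); intros y.
    apply (is_derive_eq _ _ (INR 1 * B 0%nat y - 1)); [|rewrite H0; simpl; ring].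
    apply is_derive_Rminus; [now apply bernoulli_derive | auto_derive; auto]. }
  destruct (HB 1%nat ltac:(lia)) as [_ Hi].
  rewrite (RInt_eq _ (fun t => t + B 1%nat 0)) in Hi by auto.
  rewrite (RInt_FTC (fun t => t ^ 2 / 2 + B 1%nat 0 * t)) in Hi.
  - rewrite E; simpl in Hi; lra.
  - lra.
  - intros; auto_derive; auto; simpl; field.
  - intros; cont.
Qed.

(** By induction the two sides have the same derivative; they differ by a constant, which vanishes
    because both have mean zero over [0,1]. *)
Lemma bernoulli_reflection (B : nat -> R -> R) (n : nat) :
  bernoulli_polynomials B -> forall x, B n (1 - x) = (-1) ^ n * B n x.
Proof.
  intros hB; pose proof hB as [_ [H0 HB]].
  induction n as [|n IH]; intros x; [rewrite !H0; simpl; ring|].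
  set (D := fun x => B (S n) (1 - x) - (-1) ^ S n * B (S n) x).
  assert (Hc : forall x, D x = D 0).
  { apply derive_zero_constant; intros t.
    apply (is_derive_eq _ _ (-1 * (INR (S n) * B n (1 - t))
                             - (-1) ^ S n * (INR (S n) * B n t)));
      [|rewrite IH; simpl; ring].
    apply is_derive_Rminus.
    - apply (is_derive_comp (B (S n)) (fun t => 1 - t)).
      + now apply bernoulli_derive.
      + auto_derive; auto.
    - now apply is_derive_scal, bernoulli_derive. }
  assert (Cb : forall t, continuous (B (S n)) t)
    by (intros; now apply bernoulli_continuous).
  destruct (HB (S n) ltac:(lia)) as [_ Hi].
  assert (Hr : RInt (fun t => B (S n) (1 - t)) 0 1 = 0).
  { pose proof (RInt_comp_lin (V := R_CompleteNormedModule) (B (S n)) (-1) 1 0 1) as L.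
    replace (-1 * 0 + 1) with 1 in L by ring.
    replace (-1 * 1 + 1) with 0 in L by ring.
    rewrite <- (opp_RInt_swap (V := R_CompleteNormedModule) (B (S n)) 0 1) in L
      by now apply ex_RInt_cont.
    rewrite Hi in L.
    rewrite (RInt_eq _ (fun y => (-1) * ((-1) * B (S n) ((-1) * y + 1)))).
    2:{ intros t; replace (-1 * t + 1) with (1 - t) by ring; ring. }
    rewrite RInt_mul_const.
    - specialize (L (ex_RInt_cont _ _ _ Cb)).
      change (RInt (fun y => -1 * B (S n) (-1 * y + 1)) 0 1 = - 0) in L.
      rewrite L; toR; ring.
    - intros t; cont.
      apply (continuous_comp (fun t => -1 * t + 1) (B (S n))); cont. }
  assert (Hi2 : RInt D 0 1 = 0).
  { assert (Cr : forall t, continuous (fun t => B (S n) (1 - t)) t).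
    { intros t; apply (continuous_comp (fun t => 1 - t) (B (S n))); cont. }
    unfold D; rewrite RInt_sub, RInt_mul_const, Hr, Hi by (intros; cont).
    toR; ring. }
  rewrite (RInt_eq _ (fun _ => D 0)), RInt_cst in Hi2 by auto.
  specialize (Hc x); unfold D at 1 in Hc; lra.
Qed.

Lemma bernoulli_endpoints (B : nat -> R -> R) (n : nat) :
  bernoulli_polynomials B -> (2 <= n)%nat -> B n 1 = B n 0.
Proof.
  intros [_ [_ HB]] Hn; destruct (HB n ltac:(lia)) as [H _].
  specialize (H 0); rewrite Rplus_0_l in H.
  destruct n as [|[|n]]; try lia.
  replace (S (S n) - 1)%nat with (S n) in H by lia.
  rewrite pow_i in H by lia; lra.
Qed.

(** Reflection at 0 gives [B n 1 = - B n 0] for odd [n], whereas the endpoint values agree for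
    [n >= 2]. *)
Lemma bernoulli_odd (B : nat -> R -> R) (k : nat) :
  bernoulli_polynomials B -> (1 <= k)%nat -> B (2 * k + 1)%nat 0 = 0.
Proof.
  intros hB Hk.
  pose proof (bernoulli_reflection B (2 * k + 1) hB 0) as H.
  rewrite Rminus_0_r, bernoulli_endpoints in H by (auto; lia).
  rewrite pow_add, pow_1_even in H; lra.
Qed.

(** The normalisation that makes each function the derivative of the next, so that repeated
    integration by parts creates no numerical factors. *)
Definition nbern (B : nat -> R -> R) (n : nat) (x : R) : R := B n x / INR (fact n).

Lemma nbern_continuous (B : nat -> R -> R) (n : nat) (x : R) :
  bernoulli_polynomials B -> continuous (nbern B n) x.
Proof.
  intros hB; apply continuous_Rdiv_const.
  now apply bernoulli_continuous.
Qed.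

Lemma nbern_derive (B : nat -> R -> R) (n : nat) (x : R) :
  bernoulli_polynomials B -> is_derive (nbern B (S n)) x (nbern B n x).
Proof.
  intros hB.
  assert (HfS : INR (fact (S n)) = INR (S n) * INR (fact n))
    by (rewrite fact_simpl, mult_INR; reflexivity).
  pose proof (INR_fact_lt_0 n); pose proof (lt_0_INR (S n) ltac:(lia)).
  apply (is_derive_ext (fun t => / INR (fact (S n)) * B (S n) t));
    [intros; apply Rmult_comm|].
  apply (is_derive_eq _ _ (/ INR (fact (S n)) * (INR (S n) * B n x)));
    [now apply is_derive_scal, bernoulli_derive|].
  unfold nbern; rewrite HfS; field; lra.
Qed.

Lemma nbern_0 (B : nat -> R -> R) (x : R) :
  bernoulli_polynomials B -> nbern B 0 x = 1.
Proof. intros [_ [H _]]; unfold nbern; rewrite H; simpl; field. Qed.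

Lemma nbern_1 (B : nat -> R -> R) (x : R) :
  bernoulli_polynomials B -> nbern B 1 x = x - 1 / 2.
Proof. intros hB; unfold nbern; rewrite bernoulli_1 by assumption; simpl; field. Qed.

Lemma nbern_endpoints (B : nat -> R -> R) (n : nat) :
  bernoulli_polynomials B -> (2 <= n)%nat -> nbern B n 1 = nbern B n 0.
Proof. intros; unfold nbern; now rewrite bernoulli_endpoints. Qed.

Lemma nbern_odd (B : nat -> R -> R) (k : nat) :
  bernoulli_polynomials B -> (1 <= k)%nat -> nbern B (2 * k + 1) 0 = 0.
Proof.
  intros; unfold nbern; rewrite bernoulli_odd by assumption.
  unfold Rdiv; ring.
Qed.

Lemma nbern_mean (B : nat -> R -> R) (n : nat) :
  bernoulli_polynomials B -> (1 <= n)%nat -> RInt (nbern B n) 0 1 = 0.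
Proof.
  intros hB Hn; pose proof hB as [_ [_ HB]].
  rewrite (RInt_eq _ (fun t => / INR (fact n) * B n t))
    by (intros; apply Rmult_comm).
  rewrite RInt_mul_const by (intros; now apply bernoulli_continuous).
  destruct (HB n Hn) as [_ ->]; toR; ring.
Qed.

(** * Wirtinger's inequality *)

(* Integrate [(w' + k tan (k (t - c)) w)^2 >= 0]: the cross term is a derivative
   up to a multiple of [w^2]. *)
Lemma wirtinger_interval (w w' : R -> R) (k c x y : R) :
  (forall t, is_derive w t (w' t)) -> (forall t, continuous w' t) ->
  0 < k < 2 * PI -> x <= y -> Rabs (x - c) <= 1 / 4 -> Rabs (y - c) <= 1 / 4 ->
  k ^ 2 * RInt (fun t => w t ^ 2) x y <=
    RInt (fun t => w' t ^ 2) x y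
    + (k * (sin (k * (y - c)) / cos (k * (y - c))) * w y ^ 2
       - k * (sin (k * (x - c)) / cos (k * (x - c))) * w x ^ 2).
Proof.
  intros Hw Cw' Hk Hxy Hx Hy.
  assert (Cw : forall t, continuous w t) by (intros; eapply is_derive_cont, Hw).
  set (T := fun t => sin (k * (t - c)) / cos (k * (t - c))).
  (* With [k < 2 * PI] and [|t - c| <= 1/4] the argument stays strictly within a quarter turn of 0,
     so the tangent has no pole. *)
  assert (Hcos : forall t, x <= t <= y -> 0 < cos (k * (t - c))).
  { intros t Ht; apply Rabs_le_between in Hx, Hy.
    assert (0 <= k * (t - c + 1 / 4)) by (apply Rmult_le_pos; lra).
    assert (0 <= k * (1 / 4 - (t - c))) by (apply Rmult_le_pos; lra).
    apply cos_gt_0; lra. }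
  assert (HT : forall t, x <= t <= y -> is_derive T t (k * (1 + T t ^ 2))).
  { intros t Ht; specialize (Hcos t Ht); unfold T.
    unfold Rminus in *; auto_derive; [lra|]; field; lra. }
  assert (ET : forall t, T t = sin (k * (t - c)) / cos (k * (t - c))) by reflexivity.
  clearbody T.
  set (h := fun t => k * T t * w t ^ 2).
  set (h' := fun t => k ^ 2 * (1 + T t ^ 2) * w t ^ 2 + 2 * k * T t * w t * w' t).
  assert (Hh : forall t, x <= t <= y -> is_derive h t (h' t)).
  { intros t Ht; unfold h.
    apply (is_derive_eq _ _ (k * (k * (1 + T t ^ 2)) * w t ^ 2
                             + k * T t * (INR 2 * w' t * w t ^ pred 2))).
    - apply (is_derive_mult (K := R_AbsRing) (fun t => k * T t) (fun t => w t ^ 2)).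
      + apply is_derive_scal, HT, Ht.
      + apply is_derive_pow, Hw.
      + intros; apply Rmult_comm.
    - unfold h'; simpl; ring. }
  assert (CT : forall t, x <= t <= y -> continuous T t)
    by (intros; eapply is_derive_cont; eauto).
  assert (Ch : forall t, x <= t <= y -> continuous h' t).
  { intros t Ht; specialize (CT t Ht); unfold h'; cont. }
  assert (Ih : is_RInt h' x y (h y - h x)).
  { apply (is_RInt_derive (V := R_CompleteNormedModule) h h');
      intros t; rewrite Rmin_left, Rmax_right by lra; auto. }
  enough (0 <= RInt (fun t => (w' t ^ 2 - k ^ 2 * w t ^ 2) + h' t) x y) as H.
  { assert (E : RInt (fun t => (w' t ^ 2 - k ^ 2 * w t ^ 2) + h' t) x y
                = (RInt (fun t => w' t ^ 2) x y - k ^ 2 * RInt (fun t => w t ^ 2) x y)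
                  + (h y - h x)).
    { rewrite <- (RInt_mul_const (fun t => w t ^ 2)) by (intros; cont).
      rewrite <- (RInt_sub (fun t => w' t ^ 2) (fun t => k ^ 2 * w t ^ 2))
        by (intros; cont).
      apply is_RInt_unique, (is_RInt_plus (V := R_NormedModule)); [|exact Ih].
      apply (RInt_correct (V := R_CompleteNormedModule)), ex_RInt_cont; intros; cont. }
    rewrite E in H; unfold h in H; rewrite !ET in H; lra. }
  apply RInt_ge_0; [exact Hxy| |].
  - apply (ex_RInt_plus (V := R_NormedModule)); [|eexists; exact Ih].
    apply ex_RInt_cont; intros; cont.
  - intros t _; unfold h'.
    replace (_ + _) with ((w' t + k * T t * w t) ^ 2) by ring.
    apply pow2_ge_0.
Qed.

(** Subtracting [u a], where [u (a + 1/2) = u a], gives a function vanishing at two points half a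
    period apart. These cut [0,1] into three intervals, on each of which the local inequality
    applies for every [k < 2 * PI]; the boundary terms vanish or cancel, and [k] then tends to
    [2 * PI]. *)
Lemma wirtinger (u u' : R -> R) :
  (forall t, is_derive u t (u' t)) -> (forall t, continuous u' t) ->
  u 0 = u 1 -> RInt u 0 1 = 0 ->
  (2 * PI) ^ 2 * RInt (fun t => u t ^ 2) 0 1 <= RInt (fun t => u' t ^ 2) 0 1.
Proof.
  intros Hu Cu' Hper Hmean.
  assert (Cu : forall t, continuous u t) by (intros; eapply is_derive_cont, Hu).
  (* [u (t + 1/2) - u t] takes opposite values at 0 and 1/2 *)
  assert (exists a, 0 <= a <= 1 / 2 /\ u (a + 1 / 2) = u a) as [a [Ha Hua]].
  { set (h := fun t => u (t + 1 / 2) - u t).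
    assert (Ch : continuity h).
    { intros t; apply continuity_pt_filterlim.
      apply (continuous_Rminus (fun t => u (t + 1 / 2)) u); [|apply Cu].
      apply (continuous_comp (fun t => t + 1 / 2) u); cont. }
    destruct (IVT_gen h 0 (1 / 2) 0 Ch) as [a [Ha Hh]].
    - unfold h; replace (0 + 1 / 2) with (1 / 2) by lra.
      replace (1 / 2 + 1 / 2) with 1 by lra; rewrite <- Hper.
      unfold Rmin, Rmax; repeat destruct Rle_dec; lra.
    - rewrite Rmin_left, Rmax_right in Ha by lra.
      exists a; split; [exact Ha | unfold h in Hh; lra]. }
  set (w := fun t => u t - u a).
  assert (Hw : forall t, is_derive w t (u' t)).
  { intros t; apply (is_derive_eq _ _ (u' t - 0)); [|ring].
    apply is_derive_Rminus; [apply Hu | auto_derive; auto]. }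
  assert (Cw : forall t, continuous w t) by (intros; eapply is_derive_cont, Hw).
  (* As [u] has mean zero, subtracting the constant [u a] adds [(u a)^2] to the integral of the
     square. *)
  assert (Hle : RInt (fun t => u t ^ 2) 0 1 <= RInt (fun t => w t ^ 2) 0 1).
  { rewrite (RInt_eq (fun t => w t ^ 2)
               (fun t => u t ^ 2 + (- 2 * u a) * u t + (u a) ^ 2))
      by (intros; unfold w; ring).
    rewrite !RInt_add, RInt_mul_const, Hmean, RInt_cst by (intros; cont).
    pose proof (pow2_ge_0 (u a)); lra. }
  assert (Hpos : 0 <= RInt (fun t => u t ^ 2) 0 1).
  { apply RInt_ge_0; [lra | apply ex_RInt_cont; intros; cont | intros; apply pow2_ge_0]. }
  assert (Hk : forall k, 0 < k < 2 * PI ->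
            k ^ 2 * RInt (fun t => u t ^ 2) 0 1 <= RInt (fun t => u' t ^ 2) 0 1).
  { intros k Hk.
    apply (Rle_trans _ (k ^ 2 * RInt (fun t => w t ^ 2) 0 1)).
    { apply Rmult_le_compat_l; [apply pow2_ge_0 | exact Hle]. }
    (* Each piece lies within 1/4 of its centre. The outer centres [a - 1/4] and [a + 3/4] differ by
       the period, so the tangents at 0 and 1 coincide and their boundary terms cancel. *)
    pose proof (wirtinger_interval w u' k (a - 1 / 4) 0 a Hw Cu' Hk
      ltac:(lra) ltac:(apply Rabs_le; lra) ltac:(apply Rabs_le; lra)) as I1.
    pose proof (wirtinger_interval w u' k (a + 1 / 4) a (a + 1 / 2) Hw Cu' Hk
      ltac:(lra) ltac:(apply Rabs_le; lra) ltac:(apply Rabs_le; lra)) as I2.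
    pose proof (wirtinger_interval w u' k (a + 3 / 4) (a + 1 / 2) 1 Hw Cu' Hk
      ltac:(lra) ltac:(apply Rabs_le; lra) ltac:(apply Rabs_le; lra)) as I3.
    replace (w a) with 0 in I1, I2 by (unfold w; lra).
    replace (w (a + 1 / 2)) with 0 in I2, I3 by (unfold w; lra).
    replace (w 1) with (w 0) in I3 by (unfold w; lra).
    replace (1 - (a + 3 / 4)) with (0 - (a - 1 / 4)) in I3 by lra.
    rewrite <- (RInt_split (fun t => w t ^ 2) 0 a 1) by (intros; cont).
    rewrite <- (RInt_split (fun t => w t ^ 2) a (a + 1 / 2) 1) by (intros; cont).
    rewrite <- (RInt_split (fun t => u' t ^ 2) 0 a 1) by (intros; cont).
    rewrite <- (RInt_split (fun t => u' t ^ 2) a (a + 1 / 2) 1) by (intros; cont).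
    rewrite pow_i in I1, I2, I3 by lia; lra. }
  set (J := RInt (fun t => u t ^ 2) 0 1) in *.
  set (K := RInt (fun t => u' t ^ 2) 0 1) in *.
  pose proof PI_RGT_0 as Pi0.
  (* Passage to the limit by contradiction: if [K < (2 * PI)^2 * J], then [r = sqrt (K / J)] is
     below [2 * PI], and the midpoint of [r] and [2 * PI] violates [Hk]. *)
  destruct (Rle_or_lt ((2 * PI) ^ 2 * J) K) as [|Hlt]; [assumption|exfalso].
  destruct (Req_dec J 0) as [E0|Ne]; [specialize (Hk PI ltac:(lra)); rewrite E0 in *; lra|].
  assert (0 <= K) by (specialize (Hk PI ltac:(lra)); pose proof (pow2_ge_0 PI); nra).
  set (r := sqrt (K / J)).
  assert (Hr : r ^ 2 = K / J).
  { simpl; rewrite Rmult_1_r; apply sqrt_sqrt.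
    apply Rmult_le_pos; [assumption | left; apply Rinv_0_lt_compat; lra]. }
  assert (Hr0 : 0 <= r) by apply sqrt_pos.
  assert (HrK : r ^ 2 * J = K) by (rewrite Hr; field; exact Ne).
  assert (Hr2 : r < 2 * PI).
  { destruct (Rlt_or_le r (2 * PI)) as [|Hge]; [assumption|exfalso].
    assert ((2 * PI) ^ 2 <= r ^ 2) by (apply pow_incr; lra); nra. }
  specialize (Hk ((r + 2 * PI) / 2) ltac:(lra)).
  assert (r ^ 2 < ((r + 2 * PI) / 2) ^ 2) by nra; nra.
Qed.

(** * L2 bounds for the normalised Bernoulli polynomials *)

Definition bernoulli_l2 (m : nat) : R := 29 / 100 / (2 * PI) ^ (m - 1).

Lemma bernoulli_l2_pos (m : nat) : 0 < bernoulli_l2 m.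
Proof.
  pose proof PI_RGT_0; unfold bernoulli_l2.
  apply Rdiv_lt_0_compat; [lra | apply pow_lt; lra].
Qed.

Lemma bernoulli_l2_bound (B : nat -> R -> R) (m : nat) :
  bernoulli_polynomials B -> (1 <= m)%nat ->
  RInt (fun t => nbern B m t ^ 2) 0 1 <= bernoulli_l2 m ^ 2.
Proof.
  intros hB Hm; induction Hm as [|m Hm IH].
  - rewrite (RInt_eq _ (fun t => (t - 1 / 2) ^ 2))
      by (intros; now rewrite nbern_1).
    rewrite (RInt_FTC (fun t => (t - 1 / 2) ^ 3 / 3)).
    (* The integral is 1/12, and [(29/100)^2 = 0.0841] is slightly larger. *)
    + unfold bernoulli_l2; simpl; lra.
    + lra.
    + intros; auto_derive; auto; simpl; field.
    + intros; cont.
  - pose proof PI_RGT_0 as Pi0.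
    assert (W : (2 * PI) ^ 2 * RInt (fun t => nbern B (S m) t ^ 2) 0 1
                <= RInt (fun t => nbern B m t ^ 2) 0 1).
    { apply (wirtinger (nbern B (S m)) (nbern B m)).
      - intros; now apply nbern_derive.
      - intros; now apply nbern_continuous.
      - symmetry; apply nbern_endpoints; [assumption | lia].
      - apply nbern_mean; [assumption | lia]. }
    unfold bernoulli_l2 in *.
    replace (S m - 1)%nat with (S (m - 1)) by lia.
    change ((2 * PI) ^ S (m - 1)) with (2 * PI * (2 * PI) ^ (m - 1)).
    set (q := (2 * PI) ^ (m - 1)) in *.
    assert (0 < q) by (apply pow_lt; lra).
    apply (Rmult_le_reg_l ((2 * PI) ^ 2)); [apply pow_lt; lra|].
    eapply Rle_trans; [exact W|]; eapply Rle_trans; [exact IH|].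
    right; field; lra.
Qed.

(** * Euler-Maclaurin summation *)

(** The derivatives are carried as a family of functions on all of R, so that integration by parts
    on the cells needs no conditions at 0 and 1. *)
Definition smooth_chain (m : nat) (g : nat -> R -> R) : Prop :=
  (forall k x, (k < m)%nat -> is_derive (g k) x (g (S k) x)) /\
  (forall k x, (k <= m)%nat -> continuous (g k) x).

(** The argument has the shape [a * t + b] to match the affine change of variables, which maps the
    cell onto [0,1]. *)
Definition cell_integral (Q g : R -> R) (p k : nat) : R :=
  RInt (fun t => Q (INR p * t + - INR k) * g t)
    (INR k / INR p) (INR (S k) / INR p).

(** The integral over [0,1] of [g] against the periodic Bernoulli function at [p * t]; cutting at
    the nodes replaces the fractional part of [p * t] by [p * t - k]. *)
Definition bernoulli_remainder (B : nat -> R -> R) (m : nat) (g : R -> R) (p : nat) : R :=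
  sum_f_R0 (cell_integral (nbern B m) g p) (p - 1).

Definition rtrap (u : R -> R) (p : nat) : R :=
  (u 0 + u 1) / (2 * INR p)
  + / INR p * sum_n_m (fun k => u (INR k / INR p)) 1 (p - 1).

Lemma cell_continuous (Q : R -> R) (a b : R) :
  (forall t, continuous Q t) -> forall t, continuous (fun t => Q (a * t + b)) t.
Proof. intros CQ t; apply (continuous_comp (fun t => a * t + b) Q); cont. Qed.

Lemma cell_le (p k : nat) : (1 <= p)%nat -> INR k / INR p <= INR (S k) / INR p.
Proof.
  intros Hp; apply le_INR in Hp; simpl in Hp.
  apply Rmult_le_compat_r; [left; apply Rinv_0_lt_compat; lra|].
  rewrite S_INR; lra.
Qed.

Lemma cell_length (p k : nat) :
  (1 <= p)%nat -> INR (S k) / INR p - INR k / INR p = / INR p.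
Proof. intros Hp; apply le_INR in Hp; simpl in Hp; rewrite S_INR; field; lra. Qed.

Lemma cell_endpoints (p k : nat) : (1 <= p)%nat ->
  INR p * (INR k / INR p) + - INR k = 0 /\ INR p * (INR (S k) / INR p) + - INR k = 1.
Proof.
  intros Hp; apply le_INR in Hp; simpl in Hp; rewrite S_INR; split; field; lra.
Qed.

Lemma RInt_cell_rescale (Q : R -> R) (p k : nat) :
  (1 <= p)%nat -> (forall t, continuous Q t) ->
  RInt (fun t => Q (INR p * t + - INR k)) (INR k / INR p) (INR (S k) / INR p)
  = / INR p * RInt Q 0 1.
Proof.
  intros Hp CQ; destruct (cell_endpoints p k Hp) as [E0 E1].
  pose proof (RInt_comp_lin (V := R_CompleteNormedModule) Q (INR p) (- INR k)
    (INR k / INR p) (INR (S k) / INR p)) as L.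
  rewrite E0, E1 in L; specialize (L (ex_RInt_cont _ _ _ CQ)).
  rewrite <- L.
  change (fun y => scal (INR p) (Q (INR p * y + - INR k)))
    with (fun y => INR p * Q (INR p * y + - INR k)).
  rewrite (RInt_mul_const (fun y => Q (INR p * y + - INR k)))
    by now apply cell_continuous.
  apply le_INR in Hp; simpl in Hp; toR; field; lra.
Qed.

Lemma cell_integral_by_parts (B : nat -> R -> R) (n p k : nat) (u v : R -> R) :
  bernoulli_polynomials B -> (1 <= p)%nat ->
  (forall t, is_derive u t (v t)) -> (forall t, continuous v t) ->
  cell_integral (nbern B n) u p k =
  / INR p * (nbern B (S n) 1 * u (INR (S k) / INR p)
             - nbern B (S n) 0 * u (INR k / INR p)
             - cell_integral (nbern B (S n)) v p k).
Proof.
  intros hB Hp Hu Cv; unfold cell_integral.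
  destruct (cell_endpoints p k Hp) as [E0 E1].
  pose proof (cell_le p k Hp) as Hle.
  assert (Cu : forall t, continuous u t) by (intros; eapply is_derive_cont, Hu).
  assert (CP : forall j t, continuous (fun t => nbern B j (INR p * t + - INR k)) t)
    by (intros; apply cell_continuous; intros; now apply nbern_continuous).
  pose proof (RInt_FTC
    (fun t => nbern B (S n) (INR p * t + - INR k) * u t)
    (fun t => INR p * (nbern B n (INR p * t + - INR k) * u t)
              + nbern B (S n) (INR p * t + - INR k) * v t)
    (INR k / INR p) (INR (S k) / INR p) Hle) as F.
  cbv beta in F; rewrite E0, E1 in F.
  rewrite <- F; clear F.
  - rewrite (RInt_add (fun t => INR p * (nbern B n (INR p * t + - INR k) * u t)))
      by (intros; cont).
    rewrite (RInt_mul_const (fun t => nbern B n (INR p * t + - INR k) * u t))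
      by (intros; cont).
    apply le_INR in Hp; simpl in Hp; toR; field; lra.
  - intros t _.
    apply (is_derive_eq _ _ (INR p * nbern B n (INR p * t + - INR k) * u t
                             + nbern B (S n) (INR p * t + - INR k) * v t)); [|ring].
    apply (is_derive_mult (K := R_AbsRing)
             (fun t => nbern B (S n) (INR p * t + - INR k)) u).
    + apply (is_derive_comp (nbern B (S n)) (fun t => INR p * t + - INR k)).
      * now apply nbern_derive.
      * auto_derive; auto; ring.
    + apply Hu.
    + intros; apply Rmult_comm.
  - intros t _; cont.
Qed.

Lemma cell_sum_telescope (u : R -> R) (p q : nat) :
  sum_f_R0 (fun k => u (INR (S k) / INR p) - u (INR k / INR p)) q
  = u (INR (S q) / INR p) - u 0.
Proof.
  induction q as [|q IH].
  - cbn [sum_f_R0]; replace (INR 0 / INR p) with 0 by (simpl; unfold Rdiv; ring).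
    reflexivity.
  - rewrite tech5, IH; ring.
Qed.

Lemma cell_sum_RInt (u : R -> R) (p q : nat) :
  (forall t, continuous u t) ->
  sum_f_R0 (fun k => RInt u (INR k / INR p) (INR (S k) / INR p)) q
  = RInt u 0 (INR (S q) / INR p).
Proof.
  intros Cu; induction q as [|q IH].
  - cbn [sum_f_R0]; replace (INR 0 / INR p) with 0 by (simpl; unfold Rdiv; ring).
    reflexivity.
  - rewrite tech5, IH; now apply RInt_split.
Qed.

Lemma cell_sum_trapezoid (u : R -> R) (p q : nat) :
  sum_f_R0 (fun k => 1 / 2 * u (INR (S k) / INR p) + 1 / 2 * u (INR k / INR p)) q
  = (u 0 + u (INR (S q) / INR p)) / 2 + sum_n_m (fun k => u (INR k / INR p)) 1 q.
Proof.
  induction q as [|q IH].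
  - rewrite sum_n_m_zero by lia; change (@zero _) with 0.
    cbn [sum_f_R0]; replace (INR 0 / INR p) with 0 by (simpl; unfold Rdiv; ring).
    toR; field.
  - rewrite tech5, IH, sum_n_Sm by lia.
    change (@plus _) with Rplus; toR; field.
Qed.

Lemma last_node (p : nat) : (1 <= p)%nat -> INR (S (p - 1)) / INR p = 1.
Proof.
  intros Hp; replace (S (p - 1)) with p by lia.
  apply le_INR in Hp; simpl in Hp; field; lra.
Qed.

(** Integration by parts against [P_0 = 1]: the endpoint values 1/2 and -1/2 of [P_1] produce the
    weights of the trapezoidal rule. *)
Lemma bernoulli_remainder_0 (B : nat -> R -> R) (p : nat) (u v : R -> R) :
  bernoulli_polynomials B -> (1 <= p)%nat ->
  (forall t, is_derive u t (v t)) -> (forall t, continuous v t) ->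
  RInt u 0 1 = rtrap u p - / INR p * bernoulli_remainder B 1 v p.
Proof.
  intros hB Hp Hu Cv.
  assert (Cu : forall t, continuous u t) by (intros; eapply is_derive_cont, Hu).
  rewrite <- (last_node p Hp), <- cell_sum_RInt by assumption.
  transitivity (sum_f_R0 (fun k =>
    (1 / 2 * u (INR (S k) / INR p) + 1 / 2 * u (INR k / INR p)) * / INR p
    - cell_integral (nbern B 1) v p k * / INR p) (p - 1)).
  - apply sum_eq; intros k _.
    transitivity (cell_integral (nbern B 0) u p k).
    + apply RInt_ext; intros; rewrite nbern_0 by assumption; toR; ring.
    + rewrite (cell_integral_by_parts B 0 p k u v) by assumption.
      rewrite !nbern_1 by assumption; field; apply not_0_INR; lia.
  - rewrite minus_sum, <- !scal_sum, cell_sum_trapezoid, last_node by assumption.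
    unfold rtrap, bernoulli_remainder; apply le_INR in Hp; simpl in Hp; toR; field; lra.
Qed.

(** From index 2 on, the endpoint values of [P_(m+1)] agree, so the boundary terms of neighbouring
    cells telescope. *)
Lemma bernoulli_remainder_S (B : nat -> R -> R) (m p : nat) (u v : R -> R) :
  bernoulli_polynomials B -> (1 <= m)%nat -> (1 <= p)%nat ->
  (forall t, is_derive u t (v t)) -> (forall t, continuous v t) ->
  bernoulli_remainder B m u p =
  / INR p * (nbern B (S m) 0 * (u 1 - u 0) - bernoulli_remainder B (S m) v p).
Proof.
  intros hB Hm Hp Hu Cv; unfold bernoulli_remainder.
  transitivity (sum_f_R0 (fun k =>
    (u (INR (S k) / INR p) - u (INR k / INR p)) * (/ INR p * nbern B (S m) 0)
    - cell_integral (nbern B (S m)) v p k * / INR p) (p - 1)).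
  - apply sum_eq; intros k _.
    rewrite (cell_integral_by_parts B m p k u v) by assumption.
    rewrite nbern_endpoints by (assumption || lia); ring.
  - rewrite minus_sum, <- !scal_sum, cell_sum_telescope, last_node by assumption.
    ring.
Qed.

Lemma euler_maclaurin (B : nat -> R -> R) (m p : nat) (g : nat -> R -> R) :
  bernoulli_polynomials B -> (1 <= m)%nat -> (1 <= p)%nat -> smooth_chain m g ->
  RInt (g O) 0 1 =
    rtrap (g O) p
    - sum_n_m (fun k => nbern B (2 * k) 0 / INR p ^ (2 * k)
                        * (g (2 * k - 1)%nat 1 - g (2 * k - 1)%nat 0)) 1 (m / 2)
    + (-1) ^ m / INR p ^ m * bernoulli_remainder B m (g m) p.
Proof.
  intros hB Hm Hp; pose proof (le_INR _ _ Hp) as Hp'; simpl in Hp'.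
  induction Hm as [|m Hm IH]; intros [Hd Hc].
  - rewrite (bernoulli_remainder_0 B p (g O) (g 1%nat))
      by (auto; intros; apply Hd; lia).
    rewrite sum_n_m_zero by (simpl; lia); change (@zero _) with 0; toR.
    field; lra.
  - rewrite IH by (split; intros; [apply Hd | apply Hc]; lia).
    rewrite (bernoulli_remainder_S B m p (g m) (g (S m)))
      by (auto; intros; apply Hd; lia).
    pose proof (pow_lt (INR p) m ltac:(lra)).
    (* The new boundary term carries the Bernoulli number of index [m + 1]: it vanishes for even
       [m], and is the next term of the sum for odd [m]. *)
    destruct (Nat.Even_or_Odd m) as [[j Hj]|[j Hj]].
    + replace (S m / 2)%nat with (m / 2)%nat.
      2:{ subst m; rewrite Nat.mul_comm, Nat.div_mul by lia.
          apply (Nat.div_unique _ _ _ 1); lia. }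
      replace (nbern B (S m) 0) with 0.
      2:{ replace (S m) with (2 * j + 1)%nat by lia.
          symmetry; apply nbern_odd; [assumption | lia]. }
      simpl pow; toR; field; lra.
    + replace (S m / 2)%nat with (S (m / 2)).
      2:{ replace (m / 2)%nat with j by (apply (Nat.div_unique _ _ _ 1); lia).
          apply (Nat.div_unique _ _ _ 0); lia. }
      rewrite sum_n_Sm by lia; change (@plus _) with Rplus; toR.
      replace (2 * S (m / 2))%nat with (S m).
      2:{ replace (m / 2)%nat with j by (apply (Nat.div_unique _ _ _ 1); lia). lia. }
      replace (S m - 1)%nat with m by lia.
      replace ((-1) ^ m) with (-1) by (subst m; rewrite pow_add, pow_1_even; ring).
      replace ((-1) ^ S m) with 1
        by (subst m; replace (S (2 * j + 1)) with (2 * S j)%nat by lia;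
            now rewrite pow_1_even).
      simpl pow; toR; field; lra.
Qed.

(* [Q^2 / s + s >= 2 |Q|] turns the L2 bound on [Q] into an L1 bound; the mean of
   [Q] being zero, a constant may be subtracted from [g] first. *)
Lemma cell_integral_bound (B : nat -> R -> R) (m p k : nat) (g : R -> R) (c M : R) :
  bernoulli_polynomials B -> (1 <= m)%nat -> (1 <= p)%nat ->
  (forall t, continuous g t) ->
  (forall t, INR k / INR p <= t <= INR (S k) / INR p -> Rabs (g t - c) <= M) ->
  Rabs (cell_integral (nbern B m) g p k) <= / INR p * (M * bernoulli_l2 m).
Proof.
  intros hB Hm Hp Cg Hg.
  pose proof (bernoulli_l2_pos m) as Hs.
  pose proof (bernoulli_l2_bound B m hB Hm) as HB2.
  pose proof (cell_le p k Hp) as Hle; pose proof (cell_length p k Hp) as Hlen.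
  set (s := bernoulli_l2 m) in *.
  set (a := INR k / INR p) in *; set (b := INR (S k) / INR p) in *.
  assert (Hip : 0 < / INR p) by (apply Rinv_0_lt_compat, lt_0_INR; lia).
  assert (HM : 0 <= M).
  { eapply Rle_trans; [apply Rabs_pos | apply (Hg a); lra]. }
  set (Q := fun t => nbern B m (INR p * t + - INR k)).
  assert (CQ : forall t, continuous Q t)
    by (intros; apply cell_continuous; intros; now apply nbern_continuous).
  assert (E : cell_integral (nbern B m) g p k = RInt (fun t => Q t * (g t - c)) a b).
  { rewrite (RInt_eq (fun t => Q t * (g t - c)) (fun t => Q t * g t - c * Q t))
      by (intros; ring).
    rewrite (RInt_sub (fun t => Q t * g t)), RInt_mul_const by (intros; cont).
    unfold Q at 2, a, b; rewrite (RInt_cell_rescale (nbern B m)), nbern_mean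
      by (intros; auto; now apply nbern_continuous).
    unfold cell_integral; fold a b; fold Q.
    change (fun t => nbern B m (INR p * t + - INR k) * g t) with (fun t => Q t * g t).
    toR; ring. }
  set (D := fun t => M / (2 * s) * Q t ^ 2 + M * s / 2).
  assert (ED : RInt D a b <= / INR p * (M * s)).
  { unfold D; rewrite RInt_add, RInt_mul_const, RInt_cst by (intros; cont).
    unfold Q, a, b; rewrite (RInt_cell_rescale (fun t => nbern B m t ^ 2))
      by (auto; intros; cont; now apply nbern_continuous).
    fold a b; rewrite Hlen.
    apply Rle_trans with (M / (2 * s) * (/ INR p * s ^ 2) + / INR p * (M * s / 2)).
    - apply Rplus_le_compat_r, Rmult_le_compat_l, Rmult_le_compat_l; try lra.
      apply Rmult_le_pos; [lra | left; apply Rinv_0_lt_compat; lra].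
    - right; field; split; [apply not_0_INR; lia | lra]. }
  assert (Hdom : forall t, a < t < b -> Rabs (Q t * (g t - c)) <= D t).
  { intros t Ht; rewrite Rabs_mult.
    apply Rle_trans with (Rabs (Q t) * M).
    - apply Rmult_le_compat_l; [apply Rabs_pos | apply Hg; lra].
    - unfold D; rewrite <- pow2_abs.
      assert (0 <= M / (2 * s) * (Rabs (Q t) - s) ^ 2).
      { apply Rmult_le_pos; [|apply pow2_ge_0].
        apply Rmult_le_pos; [lra | left; apply Rinv_0_lt_compat; lra]. }
      replace (M / (2 * s) * Rabs (Q t) ^ 2 + M * s / 2)
        with (M / (2 * s) * (Rabs (Q t) - s) ^ 2 + Rabs (Q t) * M) by (field; lra).
      lra. }
  assert (CD : forall t, continuous D t) by (intros; unfold D; cont).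
  rewrite E; eapply Rle_trans; [|exact ED].
  apply Rabs_le; split.
  - replace (- RInt D a b) with (-1 * RInt D a b) by ring.
    rewrite <- (RInt_mul_const D) by assumption.
    apply RInt_le; [exact Hle | apply ex_RInt_cont; intros; cont
                   | apply ex_RInt_cont; intros; cont |].
    intros t Ht; specialize (Hdom t Ht); apply Rabs_le_between in Hdom; lra.
  - apply RInt_le; [exact Hle | apply ex_RInt_cont; intros; cont
                   | now apply ex_RInt_cont |].
    intros t Ht; specialize (Hdom t Ht); apply Rabs_le_between in Hdom; lra.
Qed.

(** The constants [c k] may change from cell to cell: zero gives the uniform bound, and the value of
    [g] at the left node gives the limit. *)
Lemma bernoulli_remainder_bound_osc (B : nat -> R -> R) (m p : nat) (g : R -> R)
  (c : nat -> R) (M : R) :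
  bernoulli_polynomials B -> (1 <= m)%nat -> (1 <= p)%nat ->
  (forall t, continuous g t) ->
  (forall k t, (k < p)%nat -> INR k / INR p <= t <= INR (S k) / INR p ->
     Rabs (g t - c k) <= M) ->
  Rabs (bernoulli_remainder B m g p) <= M * bernoulli_l2 m.
Proof.
  intros hB Hm Hp Cg Hg; unfold bernoulli_remainder.
  eapply Rle_trans; [apply sum_f_R0_triangle|].
  apply Rle_trans with (sum_f_R0 (fun _ => / INR p * (M * bernoulli_l2 m)) (p - 1)).
  - apply sum_Rle; intros k Hk.
    apply (cell_integral_bound B m p k g (c k) M); auto.
    intros t Ht; apply (Hg k t); [lia | exact Ht].
  - rewrite sum_cte; replace (S (p - 1)) with p by lia.
    right; field; apply not_0_INR; lia.
Qed.

Lemma cell_in_unit (p k : nat) (t : R) :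
  (k < p)%nat -> INR k / INR p <= t <= INR (S k) / INR p -> 0 <= t <= 1.
Proof.
  intros Hk [H1 H2]; assert (Hp : 0 < INR p) by (apply lt_0_INR; lia).
  split.
  - eapply Rle_trans; [|exact H1].
    apply Rmult_le_pos; [apply pos_INR | left; now apply Rinv_0_lt_compat].
  - eapply Rle_trans; [exact H2|].
    apply (Rmult_le_reg_r (INR p)); [exact Hp|].
    unfold Rdiv; rewrite Rmult_assoc, Rinv_l, Rmult_1_r, Rmult_1_l by lra.
    apply le_INR; lia.
Qed.

Lemma bernoulli_remainder_bound (B : nat -> R -> R) (m p : nat) (g : R -> R) (M : R) :
  bernoulli_polynomials B -> (1 <= m)%nat -> (1 <= p)%nat ->
  (forall t, continuous g t) -> (forall t, 0 <= t <= 1 -> Rabs (g t) <= M) ->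
  Rabs (bernoulli_remainder B m g p) <= M * bernoulli_l2 m.
Proof.
  intros hB Hm Hp Cg Hg.
  apply (bernoulli_remainder_bound_osc B m p g (fun _ => 0)); auto.
  intros k t Hk Ht; rewrite Rminus_0_r; apply Hg.
  now apply (cell_in_unit p k).
Qed.

(** By uniform continuity the oscillation of [g] on cells of length [1 / p] tends to 0. *)
Lemma bernoulli_remainder_lim (B : nat -> R -> R) (m : nat) (g : R -> R) :
  bernoulli_polynomials B -> (1 <= m)%nat -> (forall t, continuous g t) ->
  is_lim_seq (fun p => bernoulli_remainder B m g p) 0.
Proof.
  intros hB Hm Cg; apply is_lim_seq_spec; intros eps; simpl.
  pose proof (bernoulli_l2_pos m) as Hs.
  assert (He : 0 < eps / (2 * bernoulli_l2 m))
    by (apply Rdiv_lt_0_compat; [apply cond_pos | lra]).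
  destruct (@Heine_cor2 g 0 1 (fun x _ => proj2 (continuity_pt_filterlim g x) (Cg x))
              (mkposreal _ He)) as [d Hd]; simpl in Hd.
  destruct (nfloor_ex (/ d)) as [N [_ HN]].
  { left; apply Rinv_0_lt_compat, cond_pos. }
  exists (S N); intros p Hp; rewrite Rminus_0_r.
  assert (Hdp : / INR p < d).
  { rewrite <- (Rinv_inv d); apply Rinv_lt_contravar.
    - apply Rmult_lt_0_compat; [apply Rinv_0_lt_compat, cond_pos | apply lt_0_INR; lia].
    - eapply Rlt_le_trans; [exact HN|]; rewrite <- S_INR; now apply le_INR. }
  apply Rle_lt_trans with (eps / (2 * bernoulli_l2 m) * bernoulli_l2 m).
  - apply (bernoulli_remainder_bound_osc B m p g (fun k => g (INR k / INR p)));
      [assumption | assumption | lia | assumption |].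
    intros k t Hk Ht; left.
    pose proof (cell_length p k ltac:(lia)) as Hl; pose proof (cell_le p k ltac:(lia)).
    apply Hd.
    + now apply (cell_in_unit p k).
    + apply (cell_in_unit p k); [assumption | lra].
    + rewrite Rabs_pos_eq by lra; lra.
  - replace (eps / (2 * bernoulli_l2 m) * bernoulli_l2 m) with (eps / 2) by (field; lra).
    pose proof (cond_pos eps); lra.
Qed.

(** * Richardson extrapolation *)

(** Romberg's recursion on an arbitrary real sequence, so that it can be applied separately to each
    term of the Euler-Maclaurin formula. *)
Fixpoint extrap (u : nat -> R) (l p : nat) : R :=
  match l with
  | O => u p
  | S l' => (4 ^ l * extrap u l' (2 * p) - extrap u l' p) / (4 ^ l - 1)
  end.

Lemma pow4_gt_1 (l : nat) : 1 < 4 ^ S l.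
Proof. apply Rlt_pow_R1; [lra | lia]. Qed.

Lemma extrap_ext (u v : nat -> R) (l : nat) :
  (forall p, (1 <= p)%nat -> u p = v p) ->
  forall p, (1 <= p)%nat -> extrap u l p = extrap v l p.
Proof.
  intros H; induction l as [|l IH]; intros p Hp; [now apply H|].
  simpl extrap; rewrite !IH by lia; reflexivity.
Qed.

Lemma extrap_const (c : R) (l p : nat) : extrap (fun _ => c) l p = c.
Proof.
  revert p; induction l as [|l IH]; intros p; [reflexivity|].
  cbn [extrap]; rewrite !IH; pose proof (pow4_gt_1 l); field; lra.
Qed.

Lemma extrap_linear (u v : nat -> R) (c : R) (l p : nat) :
  extrap (fun p => u p + c * v p) l p = extrap u l p + c * extrap v l p.
Proof.
  revert p; induction l as [|l IH]; intros p; [reflexivity|].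
  cbn [extrap]; rewrite !IH; pose proof (pow4_gt_1 l); field; lra.
Qed.

Lemma extrap_sum (F : nat -> nat -> R) (l M p : nat) :
  (1 <= p)%nat ->
  extrap (fun p => sum_n_m (fun k => F k p) 1 M) l p
  = sum_n_m (fun k => extrap (F k) l p) 1 M.
Proof.
  intros Hp; induction M as [|M IH].
  - rewrite sum_n_m_zero by lia.
    rewrite (extrap_ext _ (fun _ => 0)); [apply extrap_const | | exact Hp].
    intros; now rewrite sum_n_m_zero by lia.
  - rewrite sum_n_Sm, <- IH by lia.
    rewrite (extrap_ext _ (fun p => sum_n_m (fun k => F k p) 1 M + 1 * F (S M) p));
      [| | exact Hp].
    + rewrite extrap_linear; change (@plus _) with Rplus; simpl; ring.
    + intros; rewrite sum_n_Sm by lia; change (@plus _) with Rplus; simpl; ring.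
Qed.

(** The eigenvalue of the extrapolation on the sequence [1 / p^(2k)], which doubling [p] divides by
    [4^k]. *)
Fixpoint extrap_factor (l k : nat) : R :=
  match l with
  | O => 1
  | S l' => extrap_factor l' k * ((4 ^ l / 4 ^ k - 1) / (4 ^ l - 1))
  end.

Lemma extrap_power (c : R) (k l p : nat) : (1 <= p)%nat ->
  extrap (fun p => c / INR p ^ (2 * k)) l p = extrap_factor l k * (c / INR p ^ (2 * k)).
Proof.
  revert p; induction l as [|l IH]; intros p Hp; [symmetry; apply Rmult_1_l|].
  cbn [extrap extrap_factor]; rewrite !IH by lia.
  pose proof (pow4_gt_1 l); pose proof (pow_lt 4 k ltac:(lra)).
  pose proof (pow_lt (INR p) (2 * k) ltac:(apply lt_0_INR; lia)).
  rewrite mult_INR, Rpow_mult_distr.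
  replace (INR 2 ^ (2 * k)) with (4 ^ k)
    by (rewrite pow_mult; f_equal; simpl; ring).
  field; repeat split; lra.
Qed.

Lemma extrap_factor_vanish (l k : nat) : (1 <= k <= l)%nat -> extrap_factor l k = 0.
Proof.
  induction l as [|l IH]; intros Hk; [lia|].
  cbn [extrap_factor]; destruct (Nat.eq_dec k (S l)) as [->|Hne].
  - pose proof (pow4_gt_1 l).
    replace (4 ^ S l / 4 ^ S l - 1) with 0 by (field; lra).
    unfold Rdiv; ring.
  - rewrite IH by lia; ring.
Qed.

Lemma qpoch_quarter_pos (n : nat) : 0 < qpoch (1 / 4) (1 / 4) n.
Proof.
  induction n as [|n IH]; simpl; [lra|].
  apply Rmult_lt_0_compat; [exact IH|].
  assert ((1 / 4) ^ n <= 1 ^ n) by (apply pow_incr; lra).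
  rewrite pow1 in *; lra.
Qed.

Lemma qbinom_quarter_S (n l : nat) : (S l <= n)%nat ->
  qbinom (1 / 4) n (S l)
  = qbinom (1 / 4) n l * ((1 - (1 / 4) ^ (n - l)) / (1 - (1 / 4) ^ S l)).
Proof.
  intros Hn; unfold qbinom.
  replace (n - l)%nat with (S (n - S l)) by lia.
  cbn [qpoch]; rewrite !tech_pow_Rmult.
  pose proof (qpoch_quarter_pos n); pose proof (qpoch_quarter_pos (n - S l)).
  pose proof (qpoch_quarter_pos l).
  assert (Hq : forall j, (1 / 4) ^ S j < 1) by (intros; apply pow_lt_1_compat; [lra | lia]).
  pose proof (Hq l); pose proof (Hq (n - S l)%nat).
  field; repeat split; lra.
Qed.

(** Exhibits [2 ^ (l * (1 + l))] as the product of the [4^i] for [i] from 1 to [l]. *)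
Lemma pow2_triangular_S (l : nat) :
  2 ^ (S l * (1 + S l)) = 2 ^ (l * (1 + l)) * 4 ^ S l.
Proof.
  replace (S l * (1 + S l))%nat with (l * (1 + l) + 2 * S l)%nat by lia.
  rewrite pow_add, (pow_mult 2 2 (S l)); do 3 f_equal; ring.
Qed.

(** With [q = 1/4], the factor of level [i] is [- 4^(-i) (1 - q^(k-i)) / (1 - q^i)]: the signs and
    powers of 4 collect into the prefactor, the quotients into the q-binomial coefficient. *)
Lemma extrap_factor_qbinom (l k : nat) : (l < k)%nat ->
  extrap_factor l k = (-1) ^ l / 2 ^ (l * (1 + l)) * qbinom (1 / 4) (k - 1) l.
Proof.
  induction l as [|l IH]; intros Hk.
  - unfold qbinom; rewrite Nat.sub_0_r; simpl.
    pose proof (qpoch_quarter_pos (k - 1)); field; lra.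
  - cbn [extrap_factor]; rewrite IH, qbinom_quarter_S, pow2_triangular_S by lia.
    replace k with (S l + (k - 1 - l))%nat at 2 by lia.
    set (j := (k - 1 - l)%nat).
    pose proof (pow4_gt_1 l); pose proof (pow_lt 4 j ltac:(lra)).
    pose proof (pow_lt 2 (l * (1 + l)) ltac:(lra)).
    assert (Hi : forall n, (1 / 4) ^ n = / 4 ^ n)
      by (intros; unfold Rdiv; rewrite Rmult_1_l; apply pow_inv).
    rewrite !Hi, pow_add.
    rewrite <- (tech_pow_Rmult (-1)).
    set (a := 4 ^ S l) in *; field; repeat split; lra.
Qed.

(** What the triangle inequality yields for sequences bounded by a multiple of [1 / p^m]: the
    difference in the recursion becomes a sum, and doubling [p] contributes [1 / 2^m]. *)
Fixpoint extrap_gain (m l : nat) : R :=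
  match l with
  | O => 1
  | S l' => extrap_gain m l' * ((4 ^ l / 2 ^ m + 1) / (4 ^ l - 1))
  end.

Lemma extrap_bound (u : nat -> R) (m : nat) (C : R) (l : nat) :
  (forall p, (1 <= p)%nat -> Rabs (u p) <= C / INR p ^ m) ->
  forall p, (1 <= p)%nat -> Rabs (extrap u l p) <= extrap_gain m l * (C / INR p ^ m).
Proof.
  intros Hu; induction l as [|l IH]; intros p Hp.
  - simpl; rewrite Rmult_1_l; auto.
  - cbn [extrap extrap_gain].
    pose proof (IH p Hp) as I1; pose proof (IH (2 * p)%nat ltac:(lia)) as I2.
    pose proof (pow4_gt_1 l); pose proof (pow_lt 2 m ltac:(lra)).
    pose proof (pow_lt (INR p) m ltac:(apply lt_0_INR; lia)).
    rewrite mult_INR, Rpow_mult_distr in I2; change (INR 2) with 2 in I2.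
    unfold Rdiv at 1; rewrite Rabs_mult, (Rabs_pos_eq (/ _))
      by (left; apply Rinv_0_lt_compat; lra).
    replace (extrap_gain m l * ((4 ^ S l / 2 ^ m + 1) / (4 ^ S l - 1)) * (C / INR p ^ m))
      with ((4 ^ S l * (extrap_gain m l * (C / (2 ^ m * INR p ^ m)))
             + extrap_gain m l * (C / INR p ^ m)) * / (4 ^ S l - 1))
      by (field; repeat split; lra).
    apply Rmult_le_compat_r; [left; apply Rinv_0_lt_compat; lra|].
    unfold Rminus; eapply Rle_trans; [apply Rabs_triang|].
    rewrite Rabs_Ropp, Rabs_mult, (Rabs_pos_eq (4 ^ S l)) by lra.
    apply Rplus_le_compat; [apply Rmult_le_compat_l; lra | exact I1].
Qed.

(** One level combines linearly the sequence [p^m u(p)] and its subsequence along even indices, with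
    coefficients independent of [p]. *)
Lemma extrap_lim (u : nat -> R) (m l : nat) :
  is_lim_seq (fun p => INR p ^ m * u p) 0 ->
  is_lim_seq (fun p => INR p ^ m * extrap u l p) 0.
Proof.
  intros Hu; induction l as [|l IH]; [exact Hu|].
  assert (I2 : is_lim_seq (fun p => INR (2 * p) ^ m * extrap u l (2 * p)) 0).
  { apply (is_lim_seq_subseq (fun p => INR p ^ m * extrap u l p) 0 (fun p => (2 * p)%nat));
      [|exact IH].
    apply eventually_subseq; intros; lia. }
  pose proof (pow4_gt_1 l); pose proof (pow_lt 2 m ltac:(lra)).
  apply (is_lim_seq_ext (fun p =>
    4 ^ S l / (2 ^ m * (4 ^ S l - 1)) * (INR (2 * p) ^ m * extrap u l (2 * p))
    - / (4 ^ S l - 1) * (INR p ^ m * extrap u l p))).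
  - intros p; cbn [extrap]; rewrite mult_INR, Rpow_mult_distr; change (INR 2) with 2.
    field; split; lra.
  - set (a := 4 ^ S l / (2 ^ m * (4 ^ S l - 1))); set (b := / (4 ^ S l - 1)).
    replace (Finite 0) with (Finite (a * 0 - b * 0)) by (f_equal; ring).
    apply is_lim_seq_minus'; now apply (is_lim_seq_scal_l _ _ 0).
Qed.

(** [extrap_gain] is split into numerator and denominator, with [y] standing for [1 / 2^m], because
    the two need different inductive estimates. *)
Fixpoint gain_num (y : R) (l : nat) : R :=
  match l with O => 1 | S l' => gain_num y l' * (1 + 4 ^ l * y) end.

Fixpoint gain_den (l : nat) : R :=
  match l with O => 1 | S l' => gain_den l' * (4 ^ l - 1) end.

(** The slope 3/2 closes the induction: for [z = 4^l * y], [(1 + 3z/2)(1 + 4z) <= 1 + 6z] holds when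
    [z <= 1/12], and the hypothesis at the next level gives [z <= 1/16]. *)
Lemma gain_num_bound (y : R) (l : nat) :
  0 <= y -> 4 ^ l * y <= 1 / 4 -> 0 < gain_num y l <= 1 + 3 / 2 * (4 ^ l * y).
Proof.
  intros Hy; induction l as [|l IH]; intros Hl; [simpl in *; lra|].
  cbn [gain_num]; rewrite <- tech_pow_Rmult in *.
  pose proof (pow_lt 4 l ltac:(lra)).
  assert (0 <= 4 ^ l * y) by (apply Rmult_le_pos; lra).
  set (z := 4 ^ l * y) in *; replace (4 * 4 ^ l * y) with (4 * z) in * by (unfold z; ring).
  specialize (IH ltac:(lra)); nra.
Qed.

(* The term [/ 3 * / 4 ^ l] only serves to make the lower bound 2/3 inductive. *)
Lemma gain_den_bound (l : nat) :
  2 ^ (l * (1 + l)) * (2 / 3 + / 3 * / 4 ^ l) <= gain_den l.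
Proof.
  induction l as [|l IH]; [simpl; lra|].
  cbn [gain_den]; rewrite pow2_triangular_S.
  pose proof (pow4_gt_1 l); pose proof (pow_lt 2 (l * (1 + l)) ltac:(lra)).
  apply Rle_trans with (2 ^ (l * (1 + l)) * (2 / 3 + / 3 * / 4 ^ l) * (4 ^ S l - 1));
    [|apply Rmult_le_compat_r; lra].
  rewrite Rmult_assoc, Rmult_assoc; apply Rmult_le_compat_l; [lra|].
  rewrite <- tech_pow_Rmult in *; set (a := 4 ^ l) in *.
  assert (Ha : 1 <= a) by (apply pow_R1_Rle; lra).
  assert (Hia : / a <= 1) by (rewrite <- Rinv_1; apply Rinv_le_contravar; lra).
  replace (4 * a * (2 / 3 + / 3 * / (4 * a))) with (8 / 3 * a + / 3) by (field; lra).
  replace ((2 / 3 + / 3 * / a) * (4 * a - 1))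
    with (8 / 3 * a + 2 / 3 - / 3 * / a) by (field; lra).
  lra.
Qed.

Lemma extrap_gain_quotient (m l : nat) :
  0 < gain_den l /\ extrap_gain m l = gain_num (/ 2 ^ m) l / gain_den l.
Proof.
  induction l as [|l [IH1 IH2]]; [simpl; split; lra|].
  cbn [gain_den gain_num extrap_gain]; rewrite IH2.
  pose proof (pow4_gt_1 l); pose proof (pow_lt 2 m ltac:(lra)).
  split; [apply Rmult_lt_0_compat; lra | field; repeat split; lra].
Qed.

(** The hypothesis gives [4^l / 2^m <= 1/4], so the numerator is at most [1 + 3/8 = 11/8]; the
    denominator is at least 2/3 of [2 ^ (l * (1 + l))], and [(11/8) / (2/3) = 33/16]. *)
Lemma extrap_gain_bound (m l : nat) : (2 * l + 2 <= m)%nat ->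
  0 <= extrap_gain m l <= 33 / 16 / 2 ^ (l * (1 + l)).
Proof.
  intros Hm.
  pose proof (pow_lt 2 m ltac:(lra)) as H2m.
  pose proof (pow_lt 2 (l * (1 + l)) ltac:(lra)) as H2l.
  destruct (extrap_gain_quotient m l) as [Hd ->].
  assert (Hy : 4 ^ l * / 2 ^ m <= 1 / 4).
  { replace m with (2 * l + 2 + (m - (2 * l + 2)))%nat by lia.
    rewrite !pow_add, pow_mult; replace (2 ^ 2) with 4 by ring.
    set (j := (m - (2 * l + 2))%nat).
    assert (1 <= 2 ^ j) by (apply pow_R1_Rle; lra).
    pose proof (pow_lt 4 l ltac:(lra)).
    replace (4 ^ l * / (4 ^ l * 4 * 2 ^ j)) with (/ 4 * / 2 ^ j) by (field; lra).
    assert (/ 2 ^ j <= 1) by (rewrite <- Rinv_1; apply Rinv_le_contravar; lra).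
    lra. }
  destruct (gain_num_bound (/ 2 ^ m) l) as [Hn0 Hn]; [left; now apply Rinv_0_lt_compat | exact Hy|].
  pose proof (gain_den_bound l) as Hb.
  assert (0 < / 4 ^ l) by (apply Rinv_0_lt_compat, pow_lt; lra).
  assert (Hb' : 2 ^ (l * (1 + l)) * (2 / 3) <= gain_den l).
  { eapply Rle_trans; [|exact Hb]; apply Rmult_le_compat_l; lra. }
  split; [apply Rmult_le_pos; [lra | left; now apply Rinv_0_lt_compat]|].
  apply (Rmult_le_reg_r (gain_den l)); [exact Hd|].
  replace (gain_num (/ 2 ^ m) l / gain_den l * gain_den l)
    with (gain_num (/ 2 ^ m) l) by (field; lra).
  apply Rle_trans with (33 / 16 / 2 ^ (l * (1 + l)) * (2 ^ (l * (1 + l)) * (2 / 3))).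
  - replace (33 / 16 / 2 ^ (l * (1 + l)) * (2 ^ (l * (1 + l)) * (2 / 3))) with (11 / 8)
      by (field; lra).
    lra.
  - apply Rmult_le_compat_l; [|exact Hb'].
    apply Rmult_le_pos; [lra | left; now apply Rinv_0_lt_compat].
Qed.

(** * Derivatives relative to [0,1] *)

(** The nearest-point projection onto [0,1]: being 1-Lipschitz, it turns relative continuity on
    [0,1] into continuity on R. *)
Definition clamp (x : R) : R := Rmax 0 (Rmin 1 x).

Lemma clamp_I01 (x : R) : I01 (clamp x).
Proof. unfold clamp, I01, Rmax, Rmin; repeat destruct Rle_dec; lra. Qed.

Lemma clamp_id (x : R) : I01 x -> clamp x = x.
Proof. unfold clamp, I01, Rmax, Rmin; repeat destruct Rle_dec; lra. Qed.

Lemma clamp_lipschitz (x y : R) : Rabs (clamp y - clamp x) <= Rabs (y - x).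
Proof.
  unfold clamp, Rmax, Rmin; repeat destruct Rle_dec;
    apply Rabs_le; split; unfold Rabs; destruct Rcase_abs; lra.
Qed.

Lemma continuous_clamp {U : UniformSpace} (F : R -> U) :
  (forall x, I01 x -> filterlim F (within I01 (locally x)) (locally (F x))) ->
  forall x, continuous (fun t => F (clamp t)) x.
Proof.
  intros HF x; unfold continuous.
  apply (filterlim_comp _ _ _ clamp F _ (within I01 (locally (clamp x))));
    [|apply HF, clamp_I01].
  intros P [d Hd]; exists d; intros y Hy; apply Hd; [|apply clamp_I01].
  eapply Rle_lt_trans; [apply clamp_lipschitz | exact Hy].
Qed.

(** The little-o condition contained in [is_derive_I01], for real functions and written with
    absolute values. *)
Definition rel_derive (F : R -> R) (x l : R) : Prop :=
  forall eps : posreal, within I01 (locally x)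
    (fun y => Rabs (F y - F x - (y - x) * l) <= eps * Rabs (y - x)).

Lemma rel_derive_filterlim (F : R -> R) (x l : R) :
  rel_derive F x l -> filterlim F (within I01 (locally x)) (locally (F x)).
Proof.
  intros HF; apply filterlim_locally; intros eps.
  destruct (HF (mkposreal 1 Rlt_0_1)) as [d Hd]; simpl in Hd.
  assert (Hl : 0 < 1 + Rabs l) by (pose proof (Rabs_pos l); lra).
  assert (He : 0 < Rmin d (eps / (1 + Rabs l))).
  { apply Rmin_pos; [apply cond_pos | apply Rdiv_lt_0_compat; [apply cond_pos | exact Hl]]. }
  exists (mkposreal _ He); intros y Hy Iy.
  change (Rabs (y - x) < Rmin d (eps / (1 + Rabs l))) in Hy.
  assert (Hy1 : Rabs (y - x) < d) by (eapply Rlt_le_trans; [exact Hy | apply Rmin_l]).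
  assert (Hy2 : Rabs (y - x) < eps / (1 + Rabs l))
    by (eapply Rlt_le_trans; [exact Hy | apply Rmin_r]).
  specialize (Hd y Hy1 Iy).
  change (Rabs (F y - F x) < eps).
  replace (F y - F x) with ((F y - F x - (y - x) * l) + (y - x) * l) by ring.
  eapply Rle_lt_trans; [apply Rabs_triang|]; rewrite Rabs_mult.
  apply Rle_lt_trans with (Rabs (y - x) * (1 + Rabs l)); [lra|].
  apply (Rmult_lt_compat_r (1 + Rabs l)) in Hy2; [|exact Hl].
  replace (eps / (1 + Rabs l) * (1 + Rabs l)) with (pos eps) in Hy2 by (field; lra).
  exact Hy2.
Qed.

Lemma rel_derive_interior (F : R -> R) (x l : R) :
  0 < x < 1 -> rel_derive F x l -> is_derive (fun t => F (clamp t)) x l.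
Proof.
  intros Hx HF; split; [apply is_linear_scal_l|].
  intros y Hy eps.
  apply (is_filter_lim_locally_unique (V := R_NormedModule)) in Hy; subst y.
  destruct (HF eps) as [d Hd].
  assert (He : 0 < Rmin d (Rmin x (1 - x))).
  { apply Rmin_pos; [apply cond_pos | apply Rmin_pos; lra]. }
  exists (mkposreal _ He); intros y Hy.
  change (Rabs (y - x) < Rmin d (Rmin x (1 - x))) in Hy.
  assert (Hy1 : Rabs (y - x) < d) by (eapply Rlt_le_trans; [exact Hy | apply Rmin_l]).
  assert (Hy2 : Rabs (y - x) < Rmin x (1 - x))
    by (eapply Rlt_le_trans; [exact Hy | apply Rmin_r]).
  assert (Iy : I01 y).
  { apply Rabs_def2 in Hy2; pose proof (Rmin_l x (1 - x)); pose proof (Rmin_r x (1 - x)).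
    unfold I01; lra. }
  rewrite !clamp_id by (unfold I01 in *; lra).
  exact (Hd y Hy1 Iy).
Qed.

Lemma rel_derive_unique (F : R -> R) (x l1 l2 : R) :
  I01 x -> rel_derive F x l1 -> rel_derive F x l2 -> l1 = l2.
Proof.
  intros Ix H1 H2.
  destruct (Req_dec l1 l2) as [|Hne]; [assumption|exfalso].
  assert (He : 0 < Rabs (l1 - l2) / 3)
    by (apply Rdiv_lt_0_compat; [apply Rabs_pos_lt; lra | lra]).
  destruct (filter_and _ _ (H1 (mkposreal _ He)) (H2 (mkposreal _ He))) as [d Hd].
  simpl in Hd.
  pose proof (cond_pos d) as Hd0.
  (* Every point of [0,1] has room 1/2 on one side, so some [y] in [0,1] lies at distance exactly
     [h]. *)
  set (h := Rmin (d / 2) (1 / 2)).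
  assert (Hh : 0 < h <= d / 2 /\ h <= 1 / 2).
  { unfold h; split; [split; [apply Rmin_pos; lra | apply Rmin_l] | apply Rmin_r]. }
  assert (exists y, I01 y /\ Rabs (y - x) = h) as [y [Iy Hy]].
  { unfold I01 in *; destruct (Rle_dec x (1 / 2)).
    - exists (x + h); split; [lra|].
      replace (x + h - x) with h by ring; apply Rabs_pos_eq; lra.
    - exists (x - h); split; [lra|].
      replace (x - h - x) with (- h) by ring; rewrite Rabs_Ropp; apply Rabs_pos_eq; lra. }
  destruct (Hd y) as [D1 D2]; [change (Rabs (y - x) < d); lra | exact Iy |].
  rewrite Hy in D1, D2.
  assert (T : Rabs ((y - x) * (l1 - l2)) <= 2 * (Rabs (l1 - l2) / 3 * h)).
  { replace ((y - x) * (l1 - l2)) with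
      ((F y - F x - (y - x) * l2) - (F y - F x - (y - x) * l1)) by ring.
    unfold Rminus at 1; eapply Rle_trans; [apply Rabs_triang|].
    rewrite Rabs_Ropp; lra. }
  rewrite Rabs_mult, Hy in T.
  assert (0 < h * Rabs (l1 - l2)) by (apply Rmult_lt_0_compat; lra).
  lra.
Qed.

(* The top function is extended to R by clamping; the others are then recovered from
   it by integration. *)
Lemma extend_smooth_chain (m : nat) : forall F : nat -> R -> R,
  (forall k x, (k < m)%nat -> I01 x -> rel_derive (F k) x (F (S k) x)) ->
  (forall x, I01 x -> filterlim (F m) (within I01 (locally x)) (locally (F m x))) ->
  exists g, smooth_chain m g /\
    forall k x, (k <= m)%nat -> I01 x -> g k x = F k x.
Proof.
  induction m as [|m IH]; intros F HF HC.
  - exists (fun _ x => F O (clamp x)); split; [split|].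
    + intros; lia.
    + intros _ x _; now apply (continuous_clamp (F O)).
    + intros k x Hk Ix; replace k with O by lia; now rewrite clamp_id.
  - destruct (IH (fun k => F (S k))) as [g [[Hd Hc] Hg]].
    { intros; apply HF; [lia | assumption]. }
    { exact HC. }
    set (G := fun x => F O 0 + RInt (g O) 0 x).
    assert (C0 : forall x, continuous (g O) x) by (intros; apply Hc; lia).
    assert (HG : forall x, is_derive G x (g O x)).
    { intros x; apply (is_derive_eq _ _ (0 + g O x)); [|ring].
      apply is_derive_Rplus; [auto_derive; auto|].
      apply (is_derive_RInt (g O) _ 0); [|apply C0].
      apply filter_forall; intros y.
      now apply (RInt_correct (V := R_CompleteNormedModule)), ex_RInt_cont. }
    exists (fun k => match k with O => G | S j => g j end); split; [split|].
    + intros [|k] x Hk; [apply HG | apply Hd; lia].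
    + intros [|k] x Hk; [eapply is_derive_cont, HG | apply Hc; lia].
    + intros [|k] x Hk Ix; [|apply (Hg k x); [lia | exact Ix]].
      unfold I01 in Ix.
      (* Both functions have the same derivative on the open interval and agree at 0; at the
         endpoints continuity suffices. *)
      assert (E : F O (clamp x) - G x = F O (clamp 0) - G 0).
      { apply (is_derive_zero_constant_on (fun t => F O (clamp t) - G t)); [lra | |].
        - intros t Ht; apply (is_derive_eq _ _ (F 1%nat t - g O t)).
          + apply is_derive_Rminus; [|apply HG].
            apply rel_derive_interior; [lra | apply HF; [lia | unfold I01; lra]].
          + rewrite (Hg O) by (lia || unfold I01; lra); ring.
        - intros t _; apply continuous_Rminus; [|eapply is_derive_cont, HG].
          apply (continuous_clamp (F O)); intros y Iy.
          apply (rel_derive_filterlim _ _ (F 1%nat y)), HF; [lia | exact Iy]. }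
      rewrite !clamp_id in E by (unfold I01; lra).
      unfold G in E at 2; rewrite RInt_point in E; change (@zero _) with 0 in E; lra.
Qed.

(** * Reduction of complex values to real ones *)

(** For [c ^ 2 + s ^ 2 = 1] this is the inner product with a unit vector of the plane, so the
    modulus of [z] is the largest value attained. *)
Definition lin (c s : R) (z : C) : R := c * fst z + s * snd z.

Lemma lin_plus (c s : R) (z w : C) : lin c s (z + w)%C = lin c s z + lin c s w.
Proof. unfold lin; simpl; ring. Qed.

Lemma lin_minus (c s : R) (z w : C) : lin c s (z - w)%C = lin c s z - lin c s w.
Proof. unfold lin; simpl; ring. Qed.

Lemma lin_mult_R (c s r : R) (z : C) : lin c s (RtoC r * z)%C = r * lin c s z.
Proof. unfold lin; simpl; ring. Qed.

Lemma lin_div_R (c s r : R) (z : C) : r <> 0 -> lin c s (z / RtoC r)%C = lin c s z / r.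
Proof.
  intros Hr; unfold Cdiv; rewrite <- RtoC_inv by assumption.
  rewrite Cmult_comm, lin_mult_R; unfold Rdiv; ring.
Qed.

Lemma lin_sum_n_m (c s : R) (F : nat -> C) (a b : nat) :
  lin c s (sum_n_m F a b) = sum_n_m (fun k => lin c s (F k)) a b.
Proof.
  induction b as [|b IH].
  - destruct a as [|a]; [now rewrite !sum_n_n|].
    rewrite !sum_n_m_zero by lia; change (lin c s (RtoC 0) = 0); unfold lin; simpl; ring.
  - destruct (Nat.le_gt_cases a (S b)).
    + rewrite !sum_n_Sm, <- IH by assumption; apply lin_plus.
    + rewrite !sum_n_m_zero by lia; change (lin c s (RtoC 0) = 0); unfold lin; simpl; ring.
Qed.

Lemma lin_le_Cmod (c s : R) (z : C) : c ^ 2 + s ^ 2 = 1 -> Rabs (lin c s z) <= Cmod z.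
Proof.
  intros H; rewrite <- sqrt_Rsqr_abs; unfold Cmod, lin.
  apply sqrt_le_1_alt; unfold Rsqr.
  pose proof (pow2_ge_0 (c * snd z - s * fst z)).
  replace (fst z ^ 2 + snd z ^ 2) with ((c ^ 2 + s ^ 2) * (fst z ^ 2 + snd z ^ 2))
    by (rewrite H; ring).
  nra.
Qed.

Lemma Cmod_le_lin (z : C) (b : R) :
  (forall c s, c ^ 2 + s ^ 2 = 1 -> Rabs (lin c s z) <= b) -> Cmod z <= b.
Proof.
  intros H; destruct (Req_dec (Cmod z) 0) as [E|Hne].
  - rewrite E; eapply Rle_trans; [apply Rabs_pos | apply (H 1 0); ring].
  - assert (Hz : Cmod z ^ 2 = fst z ^ 2 + snd z ^ 2).
    { unfold Cmod; rewrite pow2_sqrt; [reflexivity|].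
      pose proof (pow2_ge_0 (fst z)); pose proof (pow2_ge_0 (snd z)); lra. }
    (* The direction of [z] itself is the one in which the functional attains the modulus. *)
    eapply Rle_trans; [|apply (H (fst z / Cmod z) (snd z / Cmod z))].
    + eapply Rle_trans; [|apply Rle_abs].
      right; unfold lin.
      replace (fst z / Cmod z * fst z + snd z / Cmod z * snd z)
        with ((fst z ^ 2 + snd z ^ 2) / Cmod z) by (field; assumption).
      rewrite <- Hz; field; assumption.
    + replace ((fst z / Cmod z) ^ 2 + (snd z / Cmod z) ^ 2)
        with ((fst z ^ 2 + snd z ^ 2) / Cmod z ^ 2) by (field; assumption).
      rewrite <- Hz; field; assumption.
Qed.

Lemma lin_continuous (c s : R) (z : C) : continuous (lin c s) z.
Proof.
  apply (continuous_plus (V := R_NormedModule) (fun z : C => c * fst z)).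
  - apply (continuous_scal_r (V := R_NormedModule) c (fun z : C => fst z)), continuous_fst.
  - apply (continuous_scal_r (V := R_NormedModule) s (fun z : C => snd z)), continuous_snd.
Qed.

Lemma norm_C_R_Cmod (z : C) : norm (V := C_R_NormedModule) z = Cmod z.
Proof.
  change (sqrt (Rabs (fst z) ^ 2 + Rabs (snd z) ^ 2) = Cmod z).
  now rewrite !pow2_abs.
Qed.

Lemma is_derive_I01_lin (f : R -> C) (x : R) (L : C) (c s : R) :
  c ^ 2 + s ^ 2 = 1 -> is_derive_I01 f x L ->
  rel_derive (fun t => lin c s (f t)) x (lin c s L).
Proof.
  intros Hcs [_ H] eps.
  assert (Hx : is_filter_lim (within I01 (locally x)) x).
  { intros P HP; apply filter_le_within; exact HP. }
  specialize (H x Hx eps).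
  revert H; apply filter_imp; intros y Hy.
  eapply Rle_trans; [|exact Hy].
  replace (lin c s (f y) - lin c s (f x) - (y - x) * lin c s L)
    with (lin c s (minus (minus (f y) (f x)) (scal (minus y x) L))).
  - eapply Rle_trans; [now apply lin_le_Cmod|].
    rewrite <- norm_C_R_Cmod; apply Rle_refl.
  - unfold lin; simpl; unfold minus, plus, opp, scal; simpl; unfold mult; simpl; ring.
Qed.

Lemma is_derive_I01_unique (f : R -> C) (x : R) (L1 L2 : C) :
  I01 x -> is_derive_I01 f x L1 -> is_derive_I01 f x L2 -> L1 = L2.
Proof.
  intros Ix H1 H2.
  assert (U : forall c s, c ^ 2 + s ^ 2 = 1 -> lin c s L1 = lin c s L2).
  { intros c s Hcs; apply (rel_derive_unique (fun t => lin c s (f t)) x);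
      [exact Ix | now apply is_derive_I01_lin | now apply is_derive_I01_lin]. }
  pose proof (U 1 0 ltac:(ring)) as U1; pose proof (U 0 1 ltac:(ring)) as U2.
  unfold lin in U1, U2; destruct L1, L2; simpl in *; f_equal; lra.
Qed.

(** [iota] selects the derivative only because it is unique, which uses that [0,1] has points
    arbitrarily close to [x] other than [x]. *)
Lemma Derive_I01_correct (f : R -> C) (x : R) :
  I01 x -> ex_derive_I01 f x -> is_derive_I01 f x (Derive_I01 f x).
Proof.
  intros Ix [L HL]; unfold Derive_I01.
  apply (iota_correct (V := C_R_CompleteNormedModule)).
  exists L; split; [exact HL|].
  intros L' HL'; now apply (is_derive_I01_unique f x).
Qed.

Lemma class_C_I01_lin (m : nat) (f : R -> C) (c s : R) :
  class_C_I01 m f -> c ^ 2 + s ^ 2 = 1 ->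
  exists g, smooth_chain m g /\
    forall k x, (k <= m)%nat -> I01 x -> g k x = lin c s (Derive_n_I01 f k x).
Proof.
  intros [Hd Hc] Hcs.
  apply (extend_smooth_chain m (fun k x => lin c s (Derive_n_I01 f k x))).
  - intros k x Hk Ix; apply (is_derive_I01_lin (Derive_n_I01 f k)); [exact Hcs|].
    apply (Derive_I01_correct (Derive_n_I01 f k)); auto.
  - intros x Ix.
    apply (filterlim_comp _ _ _ (Derive_n_I01 f m) (lin c s) _
             (locally (Derive_n_I01 f m x))); [now apply Hc | apply lin_continuous].
Qed.

(** Nothing is known of [f] off [0,1]; the continuous extensions [g] and [h] of its real and
    imaginary parts supply its integrability. *)
Lemma lin_RInt (f : R -> C) (c s : R) (g h k : R -> R) :
  (forall t, continuous g t) -> (forall t, continuous h t) ->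
  (forall t, I01 t -> g t = lin 1 0 (f t)) ->
  (forall t, I01 t -> h t = lin 0 1 (f t)) ->
  (forall t, I01 t -> k t = lin c s (f t)) ->
  lin c s (RInt (V := C_R_CompleteNormedModule) f 0 1) = RInt k 0 1.
Proof.
  intros Cg Ch Eg Eh Ek.
  assert (Ex : ex_RInt (V := C_R_NormedModule) f 0 1).
  { apply (ex_RInt_ext (V := C_R_NormedModule) (fun t => (g t, h t))).
    - intros t Ht; rewrite Rmin_left, Rmax_right in Ht by lra.
      rewrite Eg, Eh by (unfold I01; lra); unfold lin.
      destruct (f t); simpl; f_equal; ring.
    - apply (ex_RInt_fct_extend_pair (U := R_NormedModule) (V := R_NormedModule));
        simpl; now apply ex_RInt_cont. }
  pose proof (RInt_correct (V := C_R_CompleteNormedModule) f 0 1 Ex) as I.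
  symmetry; apply is_RInt_unique.
  apply (is_RInt_ext (V := R_NormedModule) (fun t => c * fst (f t) + s * snd (f t))).
  - intros t Ht; rewrite Rmin_left, Rmax_right in Ht by lra.
    rewrite Ek by (unfold I01; lra); reflexivity.
  - apply (is_RInt_plus (V := R_NormedModule));
      apply (is_RInt_scal (V := R_NormedModule)).
    + exact (is_RInt_fct_extend_fst (U := R_NormedModule) (V := R_NormedModule) f 0 1 _ I).
    + exact (is_RInt_fct_extend_snd (U := R_NormedModule) (V := R_NormedModule) f 0 1 _ I).
Qed.

Lemma lin_trapezoid (f : R -> C) (c s : R) (g : R -> R) (p : nat) :
  (1 <= p)%nat -> (forall t, I01 t -> g t = lin c s (f t)) ->
  lin c s (trapezoid f p) = rtrap g p.
Proof.
  intros Hp Hg; assert (Hp' : 0 < INR p) by (apply lt_0_INR; lia).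
  unfold trapezoid, rtrap.
  rewrite lin_plus, lin_div_R, lin_plus, lin_mult_R, lin_sum_n_m by lra.
  rewrite <- !Hg by (unfold I01; lra).
  do 2 f_equal; apply sum_n_m_ext_loc; intros k Hk; symmetry; apply Hg.
  apply (cell_in_unit p k); [lia|].
  split; [apply Rle_refl | apply cell_le; lia].
Qed.

Lemma lin_romberg (f : R -> C) (c s : R) (g : R -> R) (l : nat) :
  (forall t, I01 t -> g t = lin c s (f t)) ->
  forall p, (1 <= p)%nat -> lin c s (romberg f l p) = extrap (rtrap g) l p.
Proof.
  intros Hg; induction l as [|l IH]; intros p Hp; [now apply lin_trapezoid|].
  cbn [romberg extrap]; pose proof (pow4_gt_1 l).
  rewrite lin_div_R, lin_minus, lin_mult_R, !IH by (lia || lra); reflexivity.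
Qed.

(** * The error term, its limit and its explicit bound *)

Lemma sup_I01_ge (m : nat) (f : R -> C) (t : R) :
  class_C_I01 m f -> I01 t ->
  Cmod (Derive_n_I01 f m t) <= sup_I01 (Derive_n_I01 f m).
Proof.
  intros [_ Hc] It; set (F := Derive_n_I01 f m) in *.
  assert (CF : forall c s x, continuous (fun t => lin c s (F (clamp t))) x).
  { intros c s x; apply (continuous_comp (fun t => F (clamp t)) (lin c s));
      [apply (continuous_clamp F Hc) | apply lin_continuous]. }
  assert (Bd : forall c s, exists b, forall t, I01 t -> Rabs (lin c s (F t)) <= b).
  { intros c s.
    destruct (continuity_ab_maj (fun t => Rabs (lin c s (F (clamp t)))) 0 1 ltac:(lra))
      as [x [Hx _]].
    - intros y _; apply continuity_pt_filterlim.
      apply (continuous_comp (fun t => lin c s (F (clamp t))) Rabs);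
        [apply CF | apply continuous_Rabs].
    - exists (Rabs (lin c s (F (clamp x)))); intros y Iy.
      rewrite <- (clamp_id y Iy); apply Hx, Iy. }
  destruct (Bd 1 0) as [b1 H1], (Bd 0 1) as [b2 H2].
  set (Sset := fun y => exists t : R, I01 t /\ y = Cmod (F t)).
  (* Since [real] sends an infinite supremum to 0, a finite upper bound of the set is required
     first. *)
  assert (Ub : is_ub_Rbar Sset (b1 + b2)).
  { intros y [x [Ix ->]]; simpl; specialize (H1 x Ix); specialize (H2 x Ix).
    apply Cmod_le_lin; intros c s Hcs; unfold lin in *.
    assert (Rabs c <= 1) by (apply Rabs_le; nra).
    assert (Rabs s <= 1) by (apply Rabs_le; nra).
    eapply Rle_trans; [apply Rabs_triang|]; rewrite !Rabs_mult.
    replace (1 * fst (F x) + 0 * snd (F x)) with (fst (F x)) in H1 by ring.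
    replace (0 * fst (F x) + 1 * snd (F x)) with (snd (F x)) in H2 by ring.
    pose proof (Rabs_pos (fst (F x))); pose proof (Rabs_pos (snd (F x))); nra. }
  unfold sup_I01; fold Sset.
  destruct (Lub_Rbar_correct Sset) as [L1 L2].
  specialize (L2 _ Ub); specialize (L1 (Cmod (F t)) (ex_intro _ t (conj It eq_refl))).
  destruct (Lub_Rbar Sset); simpl in *; [exact L1 | contradiction | contradiction].
Qed.

(** Extrapolation is linear, so it may be applied to Euler-Maclaurin term by term: the integral is
    fixed, the corrections with [k <= l] disappear, those with [k > l] become the sum of the
    statement, and [e] is what becomes of the remainder. *)
Lemma extrapolated_error (B : nat -> R -> R) (m l : nat) (g : nat -> R -> R) (p : nat) (e : R) :
  bernoulli_polynomials B -> (1 <= m)%nat -> smooth_chain m g -> (1 <= p)%nat ->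
  RInt (g O) 0 1 =
    extrap (rtrap (g O)) l p
    - (-1) ^ l / 2 ^ (l * (1 + l))
      * sum_n_m (fun k => qbinom (1 / 4) (k - 1) l
                   * (B (2 * k)%nat 0 / (INR (fact (2 * k)) * INR p ^ (2 * k)))
                   * (g (2 * k - 1)%nat 1 - g (2 * k - 1)%nat 0)) (l + 1) (m / 2)
    + e ->
  e = extrap (fun p => (-1) ^ m / INR p ^ m * bernoulli_remainder B m (g m) p) l p.
Proof.
  intros hB Hm Hg Hp He.
  set (rem := fun p => (-1) ^ m / INR p ^ m * bernoulli_remainder B m (g m) p).
  set (a := fun k => nbern B (2 * k) 0 * (g (2 * k - 1)%nat 1 - g (2 * k - 1)%nat 0)).
  set (corr := (fun p => sum_n_m (fun k => a k / INR p ^ (2 * k)) 1 (m / 2)) : nat -> R).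
  assert (EM : RInt (g O) 0 1
               = extrap (rtrap (g O)) l p + (-1) * extrap corr l p + 1 * extrap rem l p).
  { rewrite <- !extrap_linear, <- (extrap_const (RInt (g O) 0 1) l p).
    apply extrap_ext; [|exact Hp]; intros q Hq.
    rewrite (euler_maclaurin B m q g) by assumption.
    unfold corr, rem.
    rewrite (sum_n_m_ext_loc (fun k => a k / INR q ^ (2 * k))
      (fun k => nbern B (2 * k) 0 / INR q ^ (2 * k)
                * (g (2 * k - 1)%nat 1 - g (2 * k - 1)%nat 0))).
    - toR; ring.
    - intros k _; unfold a, Rdiv; toR; ring. }
  enough (EC : extrap corr l p =
    (-1) ^ l / 2 ^ (l * (1 + l))
      * sum_n_m (fun k => qbinom (1 / 4) (k - 1) l
                   * (B (2 * k)%nat 0 / (INR (fact (2 * k)) * INR p ^ (2 * k)))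
                   * (g (2 * k - 1)%nat 1 - g (2 * k - 1)%nat 0)) (l + 1) (m / 2))
    by (rewrite EC in EM; fold rem; lra).
  unfold corr; rewrite (extrap_sum (fun k p => a k / INR p ^ (2 * k))) by exact Hp.
  (* Stated for every [M <= l] to cover both the whole sum, when [m / 2 <= l], and its initial
     segment otherwise. *)
  assert (Hlow : forall M, (M <= l)%nat ->
    sum_n_m (fun k => extrap (fun p => a k / INR p ^ (2 * k)) l p) 1 M = 0).
  { intros M HM; rewrite (sum_n_m_ext_loc _ (fun _ => @zero R_AbelianMonoid)).
    - apply (sum_n_m_const_zero (G := R_AbelianMonoid)).
    - intros k Hk; rewrite extrap_power, extrap_factor_vanish by lia; apply Rmult_0_l. }
  destruct (Nat.le_gt_cases (m / 2) l) as [Hle|Hgt].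
  - rewrite Hlow, sum_n_m_zero by lia; symmetry; apply Rmult_0_r.
  - rewrite (sum_n_m_Chasles _ 1 l (m / 2)), Hlow by lia.
    change (@plus _) with Rplus; rewrite Rplus_0_l, Nat.add_1_r.
    rewrite <- (sum_n_m_mult_l (K := R_Ring)); apply sum_n_m_ext_loc; intros k Hk.
    rewrite extrap_power, extrap_factor_qbinom by lia.
    change (@mult _) with Rmult; unfold a, nbern.
    pose proof (INR_fact_lt_0 (2 * k)).
    pose proof (pow_lt (INR p) (2 * k) ltac:(apply lt_0_INR; lia)).
    pose proof (pow_lt 2 (l * (1 + l)) ltac:(lra)).
    toR; field; repeat split; lra.
Qed.

(** Three terms of Leibniz's series give [PI <= 52/15], which is ample. *)
Lemma PI_sqr_bound : PI ^ 2 <= 256 / 20.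
Proof.
  pose proof PI_RGT_0 as Pi0; destruct (PI_ineq 1) as [_ H]; simpl in H.
  unfold tg_alt, PI_tg in H; simpl in H; nra.
Qed.

Theorem proposition9p3 (B : nat -> R -> R) (hB : bernoulli_polynomials B)
  (m : nat) (hm : (1 <= m)%nat)
  (f : R -> C) (hf : class_C_I01 m f)
  (l : nat) (E : nat -> C)
  (hE : forall p : nat, (1 <= p)%nat ->
    RInt (V := C_R_CompleteNormedModule) f 0 1 =
      (romberg f l p
       - RtoC ((-1) ^ l / 2 ^ (l * (1 + l)))
         * sum_n_m (fun k : nat =>
             RtoC (qbinom (1 / 4) (k - 1) l
                   * (B (2 * k)%nat 0%R / (INR (fact (2 * k)) * INR p ^ (2 * k))))
             * (Derive_n_I01 f (2 * k - 1) 1%R - Derive_n_I01 f (2 * k - 1) 0%R))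
             (l + 1) (m / 2)%nat
       + E p)%C) :
  filterlim (fun p : nat => (RtoC (INR p ^ m) * E p)%C)
    eventually (locally (RtoC 0)) /\
  ((2 * l + 2 <= m)%nat ->
   forall p : nat, (1 <= p)%nat ->
     Cmod (E p) <=
       16 / PI * (1 / (2 ^ (l * (1 + l)) * (2 * PI * INR p) ^ m))
       * sup_I01 (Derive_n_I01 f m)).
Proof.
  assert (Herr : forall c s, c ^ 2 + s ^ 2 = 1 ->
    exists g : R -> R, (forall t, continuous g t) /\
      (forall t, I01 t -> g t = lin c s (Derive_n_I01 f m t)) /\
      forall p, (1 <= p)%nat ->
        lin c s (E p)
        = extrap (fun p => (-1) ^ m / INR p ^ m * bernoulli_remainder B m g p) l p).
  { intros c s Hcs.
    destruct (class_C_I01_lin m f c s hf Hcs) as [g [Hg Eg]].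
    (* The real and imaginary parts are extended as well, for the integrability of [f]. *)
    destruct (class_C_I01_lin m f 1 0 hf ltac:(ring)) as [gr [[_ Cr] Er]].
    destruct (class_C_I01_lin m f 0 1 hf ltac:(ring)) as [gi [[_ Ci] Ei]].
    exists (g m); split; [intros; apply Hg; lia|].
    split; [intros; apply Eg; [lia | assumption]|].
    intros p Hp; apply extrapolated_error; auto.
    specialize (hE p Hp); apply (f_equal (lin c s)) in hE.
    rewrite (lin_RInt f c s (gr O) (gi O) (g O)) in hE.
    - rewrite lin_plus, lin_minus, lin_mult_R, lin_sum_n_m in hE.
      rewrite (lin_romberg f c s (g O)) in hE by (auto; intros; apply (Eg O); auto; lia).
      rewrite hE; do 3 f_equal; apply sum_n_m_ext_loc; intros k Hk.
      (* Keeps every order [2 * k - 1] in the sum at most [m], where [g] agrees with the derivatives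
         of [f]. *)
      assert (2 * (m / 2) <= m)%nat by apply Nat.Div0.mul_div_le.
      rewrite lin_mult_R, lin_minus, !Eg by (lia || unfold I01; lra); reflexivity.
    - intros; apply Cr; lia.
    - intros; apply Ci; lia.
    - intros; apply (Er O); [lia | assumption].
    - intros; apply (Ei O); [lia | assumption].
    - intros; apply (Eg O); [lia | assumption]. }
  split.
  - assert (Hlim : forall c s, c ^ 2 + s ^ 2 = 1 ->
              is_lim_seq (fun p => INR p ^ m * lin c s (E p)) 0).
    { intros c s Hcs; destruct (Herr c s Hcs) as [g [Cg [_ Hg]]].
      apply (is_lim_seq_ext_loc (fun p => INR p ^ m *
        extrap (fun p => (-1) ^ m / INR p ^ m * bernoulli_remainder B m g p) l p)).
      { exists 1%nat; intros p Hp; now rewrite Hg. }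
      apply extrap_lim.
      (* The factor [p^m] cancels the [1 / p^m] of the remainder once [p >= 1]. *)
      apply (is_lim_seq_ext_loc (fun p => (-1) ^ m * bernoulli_remainder B m g p)).
      { exists 1%nat; intros p Hp; field.
        apply pow_nonzero, not_0_INR; lia. }
      replace (Finite 0) with (Finite ((-1) ^ m * 0)) by (f_equal; ring).
      now apply (is_lim_seq_scal_l _ _ 0), bernoulli_remainder_lim. }
    (* C carries the product topology, so the real and imaginary parts are enough for the limit,
       unlike for the bound. *)
    pose proof (proj2 (is_lim_seq_spec _ _) (Hlim 1 0 ltac:(ring))) as L1.
    pose proof (proj2 (is_lim_seq_spec _ _) (Hlim 0 1 ltac:(ring))) as L2.
    apply filterlim_locally; intros eps.
    generalize (filter_and _ _ (L1 eps) (L2 eps)); apply filter_imp.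
    intros p [H1 H2]; unfold lin in H1, H2; rewrite Rminus_0_r in H1, H2.
    split; simpl.
    + change (Rabs (INR p ^ m * fst (E p) - 0 * snd (E p) - 0) < eps).
      replace (INR p ^ m * fst (E p) - 0 * snd (E p) - 0)
        with (INR p ^ m * (1 * fst (E p) + 0 * snd (E p))) by ring.
      exact H1.
    + change (Rabs (INR p ^ m * snd (E p) + 0 * fst (E p) - 0) < eps).
      replace (INR p ^ m * snd (E p) + 0 * fst (E p) - 0)
        with (INR p ^ m * (0 * fst (E p) + 1 * snd (E p))) by ring.
      exact H2.
  - intros Hl p Hp; apply Cmod_le_lin; intros c s Hcs.
    destruct (Herr c s Hcs) as [g [Cg [Eg Hg]]]; rewrite Hg by exact Hp.
    set (M := sup_I01 (Derive_n_I01 f m)).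
    assert (HgM : forall t, 0 <= t <= 1 -> Rabs (g t) <= M).
    { intros t It; rewrite Eg by exact It.
      eapply Rle_trans; [now apply lin_le_Cmod | now apply sup_I01_ge]. }
    assert (HM : 0 <= M) by (eapply Rle_trans; [apply Rabs_pos | apply (HgM 0); lra]).
    assert (Hpow : forall q, (1 <= q)%nat -> 0 < INR q ^ m)
      by (intros; apply pow_lt, lt_0_INR; lia).
    pose proof (bernoulli_l2_pos m) as Hs.
    eapply Rle_trans.
    { apply (extrap_bound _ m (M * bernoulli_l2 m)); [|exact Hp].
      intros q Hq; specialize (Hpow q Hq).
      unfold Rdiv; rewrite !Rabs_mult, pow_1_abs, Rmult_1_l.
      rewrite (Rabs_pos_eq (/ _)) by (left; now apply Rinv_0_lt_compat).
      rewrite Rmult_comm; apply Rmult_le_compat_r; [left; now apply Rinv_0_lt_compat|].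
      now apply bernoulli_remainder_bound. }
    specialize (Hpow p Hp); destruct (extrap_gain_bound m l Hl) as [_ Hgain].
    apply Rle_trans with (33 / 16 / 2 ^ (l * (1 + l)) * (M * bernoulli_l2 m / INR p ^ m)).
    { apply Rmult_le_compat_r; [|exact Hgain].
      apply Rmult_le_pos; [apply Rmult_le_pos; lra | left; now apply Rinv_0_lt_compat]. }
    pose proof PI_RGT_0 as Pi0; pose proof PI_sqr_bound as Pi2.
    pose proof (pow_lt 2 (l * (1 + l)) ltac:(lra)) as H2l.
    pose proof (pow_lt (2 * PI) (m - 1) ltac:(lra)) as Hq.
    unfold bernoulli_l2; rewrite (Rpow_mult_distr (2 * PI)).
    replace ((2 * PI) ^ m) with (2 * PI * (2 * PI) ^ (m - 1))
      by (rewrite tech_pow_Rmult; f_equal; lia).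
    set (q := (2 * PI) ^ (m - 1)) in *; set (d := 2 ^ (l * (1 + l))) in *.
    set (r := INR p ^ m) in *.
    replace (33 / 16 / d * (M * (29 / 100 / q) / r))
      with (33 / 16 * (29 / 100) * (2 * PI ^ 2) * (M / (d * (2 * PI ^ 2) * q * r)))
      by (field; repeat split; lra).
    replace (16 / PI * (1 / (d * (2 * PI * q * r))) * M)
      with (16 * (M / (d * (2 * PI ^ 2) * q * r))) by (field; repeat split; lra).
    (* Only [(33/16)(29/100)(2 PI^2) <= 16] is left, that is, [PI^2] at most about 13.37. *)
    apply Rmult_le_compat_r; [|lra].
    apply Rmult_le_pos; [exact HM | left; apply Rinv_0_lt_compat].
    assert (0 < 2 * PI ^ 2) by (apply Rmult_lt_0_compat; [lra | apply pow_lt; lra]).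
    repeat (apply Rmult_lt_0_compat; [|assumption]); assumption.
Qed.
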